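(* Let $\mathbb{k}$ be an algebraically closed field of characteristic zero, let $A\simeq \mathbb{k}Q/J$ be a finitely generated quiver algebra with vertex set $Q_0=\{0,1,\dots,n\}$, and let $v=(v_i)\in\mathbb{N}^{Q_0}$ be a dimension vector with $v_0=1$. Let $I_1,\dots,I_l$ be subsets of $\{0,\dots,n\}$ that give a covering, that is, $\bigcup_{i=1}^l I_i=\{0,\dots,n\}$, such that $0\in I_i$ for all $1\le i\le l$. Then the product of the cornering morphisms $$\mathcal{M}(A,v)\longrightarrow \prod_{i=1}^l \mathcal{M}(A_{I_i},v_{I_i})$$ induces a closed immersion on the reduced scheme underlying $\mathcal{M}(A,v)$.
   Context: All modules are left modules and all schemes (and products of schemes) are over $\mathbb{k}$. Quiver algebras. $A$ is a finitely generated associative $\mathbb{k}$-algebra with a presentation $A\simeq\mathbb{k}Q/J$, where $Q$ is a finite connected quiver with vertex set $Q_0=\{0,1,\dots,n\}$ and $J\subset\mathbb{k}Q$ is a two-sided ideal generated by linear combinations of paths of length at least one. Let $e_i\in A$, $i\in Q_0$, be the vertex idempotents. An $A$-module $M$ has dimension vector $v$ if $\dim_{\mathbb{k}}e_iM=v_i$ for all $i$. Moduli spaces. Let $\Theta_v=\{\theta=(\theta_i)\colon\mathbb{Z}^{Q_0}\to\mathbb{Q} : \sum_i\theta_iv_i=0\}$. For $\theta\in\Theta_v$, a module $M$ of dimension vector $v$ is $\theta$-stable if $\theta(N)>0$ for every nonzero proper submodule $N\subset M$, where $\theta(N)=\sum_i\theta_i\dim e_iN$. Since $v_0=1$, $v$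 is indivisible. Fix a generic $\theta\in\Theta_v$ (lying in an open chamber of the wall-and-chamber decomposition of $\Theta_v$) with $\theta_i>0$ for all $i\ne0$; then all $\theta$-stable modules $M$ are $0$-generated, i.e. there is a surjective homomorphism $Ae_0\to M$. $\mathcal{M}(A,v)=\mathcal{M}(A,v,\theta)$ denotes King's fine moduli space of isomorphism classes of $\theta$-stable $A$-modules of dimension vector $v$. It carries a tautological locally free sheaf $T=\bigoplus_{i\in Q_0}T_i$ with $\mathrm{rk}\,T_i=v_i$, together with a $\mathbb{k}$-algebra homomorphism $A\to\mathrm{End}(T)$, normalized so that $T_0$ is the trivial line bundle. Cornering. For a subset $I\subseteq\{0,\dots,n\}$ containing $0$, put $e_I=\sum_{i\in I}e_i$, $A_I=e_IAe_I$ (an algebra with unit $e_I$), and $v_I=(v_i)_{i\in I}$, which is indivisible since $v_0=1$. $\mathcal{M}(A_I,v_I)=\mathcal{M}(A_I,v_I,\theta_I)$ is the fine moduli space, defined in the same way, of isomorphism classes of $\theta_I$-stable $A_I$-modules of dimension vector $v_I$, for a suitable generic stability parameter $\theta_I\in\Theta_{v_I}$ with positive components at all $i\in I\setminus\{0\}$. The cornering morphism $\mathcal{M}(A,v)\to\mathcal{M}(A_I,v_I)$ is the morphism induced, via the universal property of $\mathcal{M}(A_I,v_I)$, by the family of $A_I$-modules $e_IT=\bigoplus_{i\in I}T_i$ on $\mathcal{M}(A,v)$; on closed points it sends $M$ to $e_IM$. *)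

(* Defs.v *)
From HB Require Import structures.
From mathcomp Require Import all_boot all_order all_algebra.

Set Implicit Arguments.
Unset Strict Implicit.
Unset Printing Implicit Defensive.

Import Order.TTheory GRing.Theory Num.Theory.
Local Open Scope ring_scope.

(* A scheme over k is identified with its functor of points on commutative    *)
(* k-algebras.  The fine moduli space M(A, v, theta) is thus the functor of   *)
(* isomorphism classes of families of theta-stable modules that it represents.*)
(* All modules are left modules, so paths compose from right to left and a    *)
(* path from i to j lies in e_j A e_i.                                        *)

Record quiver (n : nat) := Quiver {
  arrow :> finType;
  tail : arrow -> 'I_n.+1;
  head : arrow -> 'I_n.+1
}.

Definition quiver_connected n (Q : quiver n) : Prop :=
  forall i j : 'I_n.+1,
    connect (fun x y => [exists a : Q, ((tail a == x) && (head a == y))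
                                    || ((tail a == y) && (head a == x))]) i j.

Fixpoint is_walk n (Q : quiver n) (i : 'I_n.+1) (s : seq Q) : bool :=
  if s is a :: s' then (tail a == i) && is_walk (head a) s' else true.

(* A path of length [size s] is its source together with the list s of the    *)
(* arrows it traverses, first arrow first; [(i, [::])] is the trivial path.   *)
Definition qpath n (Q : quiver n) :=
  {p : 'I_n.+1 * seq Q | is_walk p.1 p.2}.

Definition qpath_length n (Q : quiver n) (p : qpath Q) : nat := size (val p).2.

Section PathAlgebra.
Variables (k : fieldType) (n : nat) (Q : quiver n).

Fixpoint path_value (P : algType k) (e : 'I_n.+1 -> P) (x : Q -> P)
    (i : 'I_n.+1) (s : seq Q) : P :=
  if s is a :: s' then path_value e x (head a) s' * x a else e i.

Definition qpath_value (P : algType k) (e : 'I_n.+1 -> P) (x : Q -> P)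
    (p : qpath Q) : P := path_value e x (val p).1 (val p).2.

Definition lincomb (P : algType k) (e : 'I_n.+1 -> P) (x : Q -> P)
    (s : seq (k * qpath Q)) : P :=
  \sum_(cp <- s) cp.1 *: qpath_value e x cp.2.

(* The path algebra kQ, up to unique isomorphism: the paths form a k-basis,   *)
(* and the relations below force products of paths to be concatenations.      *)
Record path_algebra := PathAlgebra {
  pa_alg :> algType k;
  pa_vert : 'I_n.+1 -> pa_alg;
  pa_arr : Q -> pa_alg;
  pa_orth : forall i j,
    pa_vert i * pa_vert j = if i == j then pa_vert i else 0;
  pa_sum : \sum_i pa_vert i = 1;
  pa_ends : forall a : Q,
    pa_arr a = pa_vert (head a) * pa_arr a * pa_vert (tail a);
  pa_span : forall x, exists s, x = lincomb pa_vert pa_arr s;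
  pa_free : forall s, lincomb pa_vert pa_arr s = 0 ->
    forall p, \sum_(cp <- s | cp.2 == p) cp.1 = 0
}.

Definition two_sided_ideal (P : algType k) (J : P -> Prop) : Prop :=
  [/\ J 0, forall x y, J x -> J y -> J (x + y)
    & forall x y z, J y -> J (x * y * z)].

Definition generated_ideal (P : algType k) (R : P -> Prop) (x : P) : Prop :=
  forall J, two_sided_ideal J -> (forall y, R y -> J y) -> J x.

Definition positive_comb (P : path_algebra) (x : P) : Prop :=
  exists2 s, all (fun cp => (0 < qpath_length cp.2)%N) s
           & x = lincomb (@pa_vert P) (@pa_arr P) s.

(* A k-algebra A together with an isomorphism kQ / J = A, i.e. a surjection   *)
(* kQ -> A with kernel J.                                                     *)
Record quiver_algebra := QuiverAlgebra {
  qa_path : path_algebra;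
  qa_rel : qa_path -> Prop;
  qa_rel_pos : forall x, qa_rel x -> positive_comb x;
  qa_alg :> algType k;
  qa_proj : {lrmorphism qa_path -> qa_alg};
  qa_surj : forall a, exists x, qa_proj x = a;
  qa_ker : forall x, qa_proj x = 0 <-> generated_ideal qa_rel x
}.

End PathAlgebra.

(* What the moduli problem remembers of a quiver algebra, and what A_I        *)
(* inherits: a complete set of orthogonal idempotents, one being marked.      *)
Record vertex_algebra (k : fieldType) := VertexAlgebra {
  va_alg :> algType k;
  va_vert : finType;
  va_idem : va_vert -> va_alg;
  va_root : va_vert;
  va_orth : forall i j,
    va_idem i * va_idem j = if i == j then va_idem i else 0;
  va_sum : \sum_i va_idem i = 1;
  va_root_neq0 : va_idem va_root != 0
}.

Section QuiverVertexAlgebra.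
Variables (k : fieldType) (n : nat) (Q : quiver n).

Section Paths.
Variable P : path_algebra k Q.
Local Notation e := (@pa_vert _ _ _ P).
Local Notation x := (@pa_arr _ _ _ P).

Fixpoint walk_end (i : 'I_n.+1) (s : seq Q) : 'I_n.+1 :=
  if s is a :: s' then walk_end (head a) s' else i.

Lemma is_walk_cat i s t :
  is_walk i (s ++ t) = is_walk i s && is_walk (walk_end i s) t.
Proof. by elim: s i => [|a s IHs] i //=; rewrite IHs andbA. Qed.

Lemma path_value_vert i j s : is_walk i s ->
  path_value e x i s * e j = if i == j then path_value e x i s else 0.
Proof.
case: s => [|a s] /=; first by rewrite pa_orth.
by case/andP=> /eqP <- _; rewrite pa_ends -!mulrA pa_orth;
   case: eqP; rewrite ?mulr0.
Qed.

Lemma path_value_mul i s j t : is_walk j t ->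
  path_value e x j t * path_value e x i s
  = if walk_end i s == j then path_value e x i (s ++ t) else 0.
Proof.
move=> wt; elim: s i => [|a s IHs] i /=.
  by rewrite path_value_vert // eq_sym; case: eqP => [->|].
by rewrite mulrA IHs; case: eqP; rewrite ?mul0r.
Qed.

Lemma positive_comb_ideal : two_sided_ideal (@positive_comb _ _ _ P).
Proof.
have posD y z : positive_comb y -> positive_comb z -> positive_comb (y + z :> P).
  move=> [s ps ->] [t pt ->]; exists (s ++ t); first by rewrite all_cat ps.
  by rewrite /lincomb big_cat.
have pos0 : positive_comb (0 : P) by exists [::]; rewrite // /lincomb big_nil.
have pos1 c (p : qpath Q) : (0 < qpath_length p)%N ->
    positive_comb (c *: qpath_value e x p).
  by move=> p_gt0; exists [:: (c, p)]; rewrite /= ?p_gt0 // /lincomb big_seq1.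
have pos_sum T (s : seq T) (F : T -> P) (b : pred T) :
    (forall i, b i -> positive_comb (F i)) -> all b s ->
    positive_comb (\sum_(i <- s) F i).
  move=> pF; elim: s => [|i s IHs] /=; first by rewrite big_nil.
  by case/andP=> bi bs; rewrite big_cons; apply: posD; [exact: pF|exact: IHs].
have mulp (p q : qpath Q) c : (0 < qpath_length p + qpath_length q)%N ->
    positive_comb (c *: (qpath_value e x p * qpath_value e x q)).
  case: p q => [[j t] /= wt] [[i s] /= ws]; rewrite /qpath_length /= => st_gt0.
  rewrite /qpath_value /= path_value_mul //; case: eqP => [E|_]; last first.
    by rewrite scaler0.
  have wst : is_walk i (s ++ t) by rewrite is_walk_cat ws E.
  pose r : qpath Q := exist (fun p => is_walk p.1 p.2) (i, s ++ t) wst.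
  by apply: (pos1 c r); rewrite /qpath_length /= size_cat addnC.
have mull y z : positive_comb z -> positive_comb (y * z :> P).
  move=> [s ps ->]; have [t ->] := pa_span y.
  rewrite /lincomb mulr_suml; apply: (pos_sum _ _ _ predT); last exact: all_predT.
  move=> [c p] _; rewrite mulr_sumr; apply: (pos_sum) ps => -[d q] /= q_gt0.
  by rewrite -scalerAl -scalerAr scalerA; apply: mulp; rewrite ltn_addl.
have mulr y z : positive_comb z -> positive_comb (z * y :> P).
  move=> [s ps ->]; have [t ->] := pa_span y.
  rewrite /lincomb mulr_suml; apply: (pos_sum) ps => -[c p] /= p_gt0.
  rewrite mulr_sumr; apply: (pos_sum _ _ _ predT); last exact: all_predT.
  move=> [d q] _; rewrite -scalerAl -scalerAr scalerA.
  by apply: mulp; rewrite ltn_addr.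
by split=> // y z w pz; apply/mulr/mull.
Qed.

Lemma vert_not_positive i : ~ positive_comb (e i).
Proof.
case=> s ps es.
pose p : qpath Q := exist (fun p => is_walk p.1 p.2) (i, [::]) isT.
have := @pa_free _ _ _ P ((-1, p) :: s); rewrite /lincomb big_cons -/(lincomb _ _ s).
rewrite -es scaleN1r addNr => /(_ erefl p).
rewrite big_cons eqxx big_seq_cond big1 ?addr0.
  by move/eqP; rewrite oppr_eq0 oner_eq0.
move=> [c q] /andP[/(allP ps) /= q_gt0 /eqP qp].
by move: q_gt0; rewrite qp.
Qed.

End Paths.

Variable A : quiver_algebra k Q.

Definition qa_idem (i : 'I_n.+1) : A := qa_proj A (pa_vert _ i).

Lemma qa_orth i j : qa_idem i * qa_idem j = if i == j then qa_idem i else 0.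
Proof. by rewrite /qa_idem -rmorphM pa_orth; case: eqP; rewrite ?rmorph0. Qed.

Lemma qa_sum : \sum_i qa_idem i = 1.
Proof. by rewrite /qa_idem -rmorph_sum pa_sum rmorph1. Qed.

Lemma qa_root_neq0 : qa_idem ord0 != 0.
Proof.
apply/eqP => /(@qa_ker _ _ _ A _) /(_ _ (positive_comb_ideal _)) pos0.
exact: vert_not_positive (pos0 (@qa_rel_pos _ _ _ A)).
Qed.

Definition quiver_vertex_algebra : vertex_algebra k :=
  VertexAlgebra qa_orth qa_sum qa_root_neq0.

End QuiverVertexAlgebra.

Record nz_idempotent (k : fieldType) (A : algType k) := NzIdempotent {
  ni_val : A;
  ni_idem : ni_val * ni_val = ni_val;
  ni_neq0 : ni_val != 0
}.

Definition in_corner (k : fieldType) (A : algType k) (e : nz_idempotent A) :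
  pred A := fun a => ni_val e * a * ni_val e == a.

(* The corner algebra e A e, whose unit is e. *)
Definition corner (k : fieldType) (A : algType k) (e : nz_idempotent A) :=
  {a : A | in_corner e a}.

Section Corner.
Variables (k : fieldType) (A : algType k) (e : nz_idempotent A).
Local Notation ee := (ni_val e).
Local Notation eAe := (in_corner e).

HB.instance Definition _ := [isSub of corner e for @sval A eAe].
HB.instance Definition _ := [Choice of corner e by <:].

Lemma corner_closed : submod_closed eAe.
Proof.
split=> [|c x y /eqP hx /eqP hy]; rewrite unfold_in /= ?mulr0 ?mul0r //.
by rewrite mulrDr mulrDl -scalerAr -scalerAl hx hy.
Qed.
HB.instance Definition _ :=
  GRing.isSubmodClosed.Build k A (in_corner e) corner_closed.
HB.instance Definition _ := [SubChoice_isSubZmodule of corner e by <:].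
HB.instance Definition _ := [SubZmodule_isSubLmodule of corner e by <:].

Lemma corner_l (a : corner e) : ee * val a = val a.
Proof. by case: a => a /= /eqP <-; rewrite !mulrA ni_idem. Qed.

Lemma corner_r (a : corner e) : val a * ee = val a.
Proof. by case: a => a /= /eqP <-; rewrite -!mulrA ni_idem. Qed.

Lemma corner_one_subproof : eAe ee.
Proof. by rewrite /in_corner !ni_idem. Qed.

Lemma corner_mul_subproof (a b : corner e) : eAe (val a * val b).
Proof. by rewrite /in_corner mulrA corner_l -mulrA corner_r. Qed.

Definition corner_one : corner e := exist eAe _ corner_one_subproof.
Definition corner_mul (a b : corner e) : corner e :=
  exist eAe _ (corner_mul_subproof a b).

Fact corner_mulA : associative corner_mul.
Proof. by move=> a b c; apply: val_inj; rewrite /= mulrA. Qed.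
Fact corner_mul1r : left_id corner_one corner_mul.
Proof. by move=> a; apply: val_inj; rewrite /= corner_l. Qed.
Fact corner_mulr1 : right_id corner_one corner_mul.
Proof. by move=> a; apply: val_inj; rewrite /= corner_r. Qed.
Fact corner_mulDl : left_distributive corner_mul +%R.
Proof. by move=> a b c; apply: val_inj; rewrite /= mulrDl. Qed.
Fact corner_mulDr : right_distributive corner_mul +%R.
Proof. by move=> a b c; apply: val_inj; rewrite /= mulrDr. Qed.
Fact corner_1neq0 : corner_one != 0.
Proof. by rewrite -val_eqE /= ni_neq0. Qed.
HB.instance Definition _ := GRing.Zmodule_isNzRing.Build (corner e)
  corner_mulA corner_mul1r corner_mulr1 corner_mulDl corner_mulDr corner_1neq0.

Fact corner_scaleAl (c : k) (a b : corner e) : c *: (a * b) = (c *: a) * b.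
Proof. by apply: val_inj; rewrite /= scalerAl. Qed.
HB.instance Definition _ :=
  GRing.Lmodule_isLalgebra.Build k (corner e) corner_scaleAl.

Fact corner_scaleAr (c : k) (a b : corner e) : c *: (a * b) = a * (c *: b).
Proof. by apply: val_inj; rewrite /= scalerAr. Qed.
HB.instance Definition _ :=
  GRing.Lalgebra_isAlgebra.Build k (corner e) corner_scaleAr.

End Corner.

Section Cornering.
Variables (k : fieldType) (A : vertex_algebra k).
Variables (I : {set va_vert A}) (I0 : va_root A \in I).

Definition idem_sum : A := \sum_(i in I) va_idem i.

Lemma idem_sum_l i : idem_sum * va_idem i = if i \in I then va_idem i else 0.
Proof.
rewrite /idem_sum mulr_suml; under eq_bigr do rewrite va_orth.
rewrite -big_mkcondr /=; case: (boolP (i \in I)) => iI.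
  rewrite (big_pred1 i) // => j /=.
  by case: eqP => [->|_]; rewrite ?iI ?andbF.
rewrite big_pred0 // => j.
by case: eqP => [->|_]; rewrite ?andbF ?(negbTE iI).
Qed.

Lemma idem_sum_r i : va_idem i * idem_sum = if i \in I then va_idem i else 0.
Proof.
rewrite /idem_sum mulr_sumr; under eq_bigr do rewrite va_orth.
rewrite -big_mkcondr /=; case: (boolP (i \in I)) => iI.
  rewrite (big_pred1 i) // => j /=.
  by rewrite eq_sym; case: eqP => [->|_]; rewrite ?iI ?andbF.
rewrite big_pred0 // => j.
by case: eqP => [<-|_]; rewrite ?andbF ?(negbTE iI).
Qed.

Lemma idem_sum_idem : idem_sum * idem_sum = idem_sum.
Proof.
rewrite {2}/idem_sum mulr_sumr; apply: eq_bigr => i iI.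
by rewrite idem_sum_l iI.
Qed.

Lemma idem_sum_neq0 : idem_sum != 0.
Proof.
apply: contraNneq (va_root_neq0 A) => e0.
by have := idem_sum_l (va_root A); rewrite I0 e0 mul0r => <-.
Qed.

Definition cornering_idem : nz_idempotent A :=
  NzIdempotent idem_sum_idem idem_sum_neq0.

Lemma corner_vert_subproof (i : {i in I}) :
  idem_sum * va_idem (val i) * idem_sum == va_idem (val i).
Proof. by rewrite idem_sum_l (valP i) idem_sum_r (valP i). Qed.

Definition corner_vert (i : {i in I}) : corner cornering_idem :=
  exist _ (va_idem (val i)) (corner_vert_subproof i).

Lemma corner_orth i j :
  corner_vert i * corner_vert j = if i == j then corner_vert i else 0.
Proof.
by apply: val_inj; rewrite /= va_orth -(inj_eq val_inj); case: ifP.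
Qed.

Lemma corner_sum : \sum_i corner_vert i = 1.
Proof.
apply: val_inj; rewrite raddf_sum /= /idem_sum.
by rewrite (big_sub (mem I)).
Qed.

Definition corner_root : {i in I} := Sub (va_root A) I0.

Lemma corner_root_neq0 : corner_vert corner_root != 0.
Proof. by rewrite -val_eqE /= va_root_neq0. Qed.

Definition corner_algebra : vertex_algebra k :=
  VertexAlgebra corner_orth corner_sum corner_root_neq0.

End Cornering.

Section Stability.
Variables (k : fieldType) (A : vertex_algebra k) (theta : va_vert A -> rat).
Variables (F : fieldType) (M : vectType F) (act : A -> 'End(M)).

Definition submodule (N : {vspace M}) : Prop :=
  forall a : A, (act a @: N <= N)%VS.

Definition theta_dim (N : {vspace M}) : rat :=
  \sum_i theta i * (\dim (act (va_idem i) @: N))%:R.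

Definition stable : Prop := forall N : {vspace M}, submodule N ->
  N != 0%VS -> N != fullv -> 0 < theta_dim N.

Definition semistable : Prop := forall N : {vspace M}, submodule N ->
  0 <= theta_dim N.

End Stability.

Definition module_action (k : fieldType) (A : vertex_algebra k)
    (M : vectType k) (act : A -> 'End(M)) : Prop :=
  [/\ linear act, act 1 = \1%VF & forall a b, act (a * b) = (act a \o act b)%VF].

Definition has_dimension_vector (k : fieldType) (A : vertex_algebra k)
    (v : va_vert A -> nat) (M : vectType k) (act : A -> 'End(M)) : Prop :=
  forall i, \dim (limg (act (va_idem i))) = v i.

(* theta lies off the walls: semistable modules of dimension v are stable *)
Definition generic_parameter (k : fieldType) (A : vertex_algebra k)
    (v : va_vert A -> nat) (theta : va_vert A -> rat) : Prop :=
  forall (M : vectType k) (act : A -> 'End(M)),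
    module_action act -> has_dimension_vector v act ->
    semistable theta act -> stable theta act.

(* A generic theta in Theta_v with theta_i > 0 away from the marked vertex *)
Definition stability_parameter (k : fieldType) (A : vertex_algebra k)
    (v : va_vert A -> nat) (theta : va_vert A -> rat) : Prop :=
  [/\ \sum_i theta i * (v i)%:R = 0,
      forall i, i != va_root A -> 0 < theta i
    & generic_parameter v theta].

(* F(B) is [pts B] modulo the relation [pull idfun]; [pull phi x y] says that *)
(* y is the image of x under F(phi) : F(B) -> F(C).  Functors of isomorphism  *)
(* classes are thereby described by representatives; the functor laws are not *)
(* needed to state the notions below and are not part of the record.          *)
Record kfunctor (k : fieldType) := KFunctor {
  pts :> comAlgType k -> Type;
  pull : forall B C : comAlgType k, {lrmorphism B -> C} -> pts B -> pts C -> Prop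
}.
Arguments pull {k} _ {B C}.

Definition same_point (k : fieldType) (X : kfunctor k) (B : comAlgType k)
  (x y : X B) : Prop := pull X idfun x y.

Definition kproduct (k : fieldType) (J : Type) (X : J -> kfunctor k) :
  kfunctor k :=
  {| pts := fun B => forall j, X j B;
     pull := fun B C phi x y => forall j, pull (X j) phi (x j) (y j) |}.

Definition ksub (k : fieldType) (X : kfunctor k)
    (Z : forall B : comAlgType k, X B -> Prop) : kfunctor k :=
  {| pts := fun B => {x : X B | Z B x};
     pull := fun B C phi x y => pull X phi (sval x) (sval y) |}.

(* Z is a closed subfunctor of X: for every x in X(B), the fibre product of   *)
(* Z and Spec B over X is the closed subscheme V(S) of Spec B, for some S.    *)
Definition closed_subfunctor (k : fieldType) (X : kfunctor k)
    (Z : forall B : comAlgType k, X B -> Prop) : Prop :=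
  forall (B : comAlgType k) (x : X B), exists S : B -> Prop,
    forall (C : comAlgType k) (phi : {lrmorphism B -> C}) (y : X C),
      pull X phi x y -> (Z C y <-> forall b, S b -> phi b = 0).

Definition reduced_ring (B : nzRingType) : Prop :=
  forall (b : B) (m : nat), b ^+ m = 0 -> b = 0.

(* The reduced scheme underlying X is the smallest closed subscheme of X      *)
(* through which all morphisms from reduced affine schemes factor.            *)
Definition red_points (k : fieldType) (X : kfunctor k) (B : comAlgType k)
    (x : X B) : Prop :=
  forall Z : forall C : comAlgType k, X C -> Prop,
    closed_subfunctor Z ->
    (forall (C : comAlgType k) (y : X C), reduced_ring C -> Z C y) ->
    Z B x.

Definition kred (k : fieldType) (X : kfunctor k) : kfunctor k :=
  ksub (@red_points k X).

(* Morphisms of k-functors, given by their graphs *)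
Definition kgraph (k : fieldType) (X Y : kfunctor k) :=
  forall B : comAlgType k, X B -> Y B -> Prop.

Definition kmorphism (k : fieldType) (X Y : kfunctor k) (f : kgraph X Y) : Prop :=
  (forall B (x : X B), exists y, f B x y) /\
  (forall (B C : comAlgType k) (phi : {lrmorphism B -> C}) x y x' y',
     f B x y -> f C x' y' -> pull X phi x x' -> pull Y phi y y').

Definition kimage (k : fieldType) (X Y : kfunctor k) (f : kgraph X Y)
    (B : comAlgType k) (y : Y B) : Prop :=
  exists x y', f B x y' /\ same_point y' y.

(* f is an isomorphism onto a closed subfunctor *)
Definition closed_immersion (k : fieldType) (X Y : kfunctor k)
    (f : kgraph X Y) : Prop :=
  [/\ kmorphism f,
      forall B x y x' y', f B x y -> f B x' y' -> same_point y y' ->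
        same_point x x'
    & closed_subfunctor (kimage f)].

(* The morphism X -> \prod_j Y_j with components f_j *)
Definition kprod_graph (k : fieldType) (J : Type) (X : kfunctor k)
    (Y : J -> kfunctor k) (f : forall j, kgraph X (Y j)) :
  kgraph X (kproduct Y) :=
  fun B x y => forall j, f j B x (y j).

(* The morphism induced by f on the reduced scheme underlying X *)
Definition kred_graph (k : fieldType) (X Y : kfunctor k) (f : kgraph X Y) :
  kgraph (kred X) Y :=
  fun B x y => f B (sval x) y.

(* u exhibits T' as the base change of T along phi *)
Definition is_base_change (B C : comNzRingType) (phi : {rmorphism B -> C})
    (T : lmodType B) (T' : lmodType C) (u : {linear T -> T' | phi \; *:%R}) :
  Prop :=
  forall (P : lmodType C) (h : {linear T -> P | phi \; *:%R}),
    (exists g : {linear T' -> P}, g \o u =1 h) /\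
    (forall g g' : {linear T' -> P}, g \o u =1 g' \o u -> g =1 g').

(* The submodule S of T is free of rank r after inverting f, with basis the   *)
(* t_j / 1; any basis of the localisation has this form up to powers of f.    *)
Definition free_after_inverting (B : comNzRingType) (T : lmodType B)
    (S : T -> Prop) (r : nat) (f : B) : Prop :=
  exists t : 'I_r -> T,
    [/\ forall j, S (t j),
        forall x, S x -> exists m (c : 'I_r -> B),
          f ^+ m *: x = \sum_j c j *: t j
      & forall c : 'I_r -> B, \sum_j c j *: t j = 0 ->
          exists m, forall j, f ^+ m * c j = 0].

Definition locally_free (B : comNzRingType) (T : lmodType B)
    (S : T -> Prop) (r : nat) : Prop :=
  exists m (f g : 'I_m -> B), \sum_i g i * f i = 1 /\
    forall i, free_after_inverting S r (f i).

Definition trivial_line (B : comNzRingType) (T : lmodType B)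
    (S : T -> Prop) : Prop :=
  exists2 t : T, S t & forall x, S x -> exists! b : B, x = b *: t.

(* A quasi-coherent sheaf T on Spec B with a k-algebra map A -> End(T) *)
Record rep (k : fieldType) (A : vertex_algebra k) (B : comAlgType k) := Rep {
  rep_mod :> lmodType B;
  rep_act : A -> {linear rep_mod -> rep_mod};
  rep_act1 : forall x, rep_act 1 x = x;
  rep_actM : forall a b x, rep_act (a * b) x = rep_act a (rep_act b x);
  rep_actP : forall (c : k) a b x,
    rep_act (c *: a + b) x = (c%:A : B) *: rep_act a x + rep_act b x
}.
Arguments rep_act {k A B} r a.

Section Moduli.
Variables (k : fieldType) (A : vertex_algebra k).
Variables (v : va_vert A -> nat) (theta : va_vert A -> rat).

(* T_i = e_i T *)
Definition rep_vert (B : comAlgType k) (T : rep A B) (i : va_vert A) (x : T) :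
  Prop := rep_act T (va_idem i) x = x.

(* Every fibre of T over a field-valued point of Spec B is stable. *)
Definition stable_fibres (B : comAlgType k) (T : rep A B) : Prop :=
  forall (F : fieldType) (phi : {rmorphism B -> F}) (M : vectType F)
    (u : {linear T -> M | phi \; *:%R}) (act : A -> 'End(M)),
    is_base_change u -> (forall a x, act a (u x) = u (rep_act T a x)) ->
    stable theta act.

(* The T_i are locally free of rank v_i and T_0 is trivial, which rigidifies  *)
(* T against twists by line bundles.                                          *)
Definition stable_family (B : comAlgType k) (T : rep A B) : Prop :=
  [/\ forall i, locally_free (rep_vert (T := T) i) (v i),
      trivial_line (rep_vert (T := T) (va_root A))
    & stable_fibres T].

Definition rep_pull (B C : comAlgType k) (phi : {lrmorphism B -> C})
    (T : rep A B) (T' : rep A C) : Prop :=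
  exists2 u : {linear T -> T' | phi \; *:%R}, is_base_change u
    & forall a x, u (rep_act T a x) = rep_act T' a (u x).

(* M(A, v, theta), as the functor of isomorphism classes of families of       *)
(* theta-stable A-modules of dimension vector v *)
Definition moduli : kfunctor k :=
  {| pts := fun B => {T : rep A B | stable_family T};
     pull := fun B C phi T T' => rep_pull phi (sval T) (sval T') |}.

End Moduli.

Definition corner_vector (k : fieldType) (A : vertex_algebra k)
    (v : va_vert A -> nat) (I : {set va_vert A}) (I0 : va_root A \in I) :
  va_vert (corner_algebra I0) -> nat := fun i => v (val i).
Arguments corner_vector {k A} v {I} I0 i.

(* The cornering morphism sends T to e_I T, i.e. to those N isomorphic to it. *)
Definition cornering (k : fieldType) (A : vertex_algebra k)
    (v : va_vert A -> nat) (theta : va_vert A -> rat)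
    (I : {set va_vert A}) (I0 : va_root A \in I)
    (thetaI : va_vert (corner_algebra I0) -> rat) :
  kgraph (moduli v theta) (moduli (corner_vector v I0) thetaI) :=
  fun B T N => exists w : {linear sval N -> sval T},
    [/\ injective w,
        forall x, (exists y, w y = x) <-> rep_act (sval T) (idem_sum I) x = x
      & forall a y,
          w (rep_act (sval N) a y) = rep_act (sval T) (val a) (w y)].
Arguments cornering {k A} v theta {I} I0 thetaI.

(* Main.v *)
(* Since v_0 = 1 and theta_i > 0 for i != 0, a module of dimension v is stable if
   and only if it is generated by its line M_0.  By Nakayama, a stable family T
   on Spec B with root section t in T_0 is then the quotient of B (x) A e_0 by
   the annihilator of t, so it is determined by the kernels K_i of
   B (x) e_i A e_0 -> T_i.  The corner e_I T has the kernels K_i, i in I; as the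
   I_j cover all vertices, the corners determine T, compatibly with base change.
   Conversely, families N_j on Spec B are the corners of some T if and only if
   the kernels of the N_j agree on common vertices and together are stable under
   A.  The N_j being finite projective, this says that certain elements of N_j
   vanish, that is, that all their coordinates do: a closed condition on Spec B.
   So M(A, v) itself is a closed subfunctor of the product, and hence so is the
   intersection of all its closed subfunctors containing its reduced points. *)

Require Import Defs.
From HB Require Import structures.
From mathcomp Require Import all_boot all_order all_algebra.
From mathcomp Require Import boolp.
From mathcomp Require classical_sets.

Set Implicit Arguments.
Unset Strict Implicit.
Unset Printing Implicit Defensive.

Import Order.TTheory GRing.Theory Num.Theory.
Local Open Scope ring_scope.

(** * Semilinear maps and linear combinations *)

(** Base change enters only through its universal property. It is constructed solely along
    surjections, as T / (ker pi) T; every other base change is given, and is used through the maps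
    out of it. In particular a relation over C need not come from relations over B, so compatibility
    over C is proved by extending a map, not by lifting relations.

    The reduced structure shapes the last step. It is an intersection of closed subfunctors Z of
    M(A, v), and Z yields equations only at a point of M(A, v), whereas over B there is just a tuple
    of corners. The gluing equations therefore come first: over their quotient D of B the corners
    glue to a point [xD], through which all others factor, and the equations of the Z at [xD] are
    lifted back to B.

    Root sections are unique only up to units, and isomorphisms of corners need not respect them.
    Comparing families thus rescales each corner by a unit, while compatibility is phrased as an
    implication between relations, which units do not affect. *)

Section LinearMaps.
Variables (B C : comNzRingType) (phi : {rmorphism B -> C}).

Lemma semilinear_ex (T : lmodType B) (P : lmodType C) (f : T -> P) :
  (forall b x y, f (b *: x + y) = phi b *: f x + f y) ->
  {g : {linear T -> P | phi \; *:%R} | g =1 f}.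
Proof.
move=> fl.
pose m := GRing.isLinear.Build B T P (phi \; *:%R) f fl.
pose g : {linear T -> P | phi \; *:%R} := HB.pack f m.
by exists g.
Qed.

Lemma linear_ex (T P : lmodType B) (f : T -> P) :
  (forall b x y, f (b *: x + y) = b *: f x + f y) ->
  {g : {linear T -> P} | g =1 f}.
Proof.
move=> fl.
pose m := GRing.isLinear.Build B T P *:%R f fl.
pose g : {linear T -> P} := HB.pack f m.
by exists g.
Qed.

Lemma semilinearZ (T : lmodType B) (P : lmodType C)
    (u : {linear T -> P | phi \; *:%R}) b x : u (b *: x) = phi b *: u x.
Proof. by rewrite linearZ_LR. Qed.

Lemma semilinear_comp (T T' : lmodType B) (P P' : lmodType C)
    (f : {linear T -> T'}) (u : {linear T' -> P | phi \; *:%R})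
    (g : {linear P -> P'}) :
  {h : {linear T -> P' | phi \; *:%R} | forall x, h x = g (u (f x))}.
Proof.
have [|h hE] := @semilinear_ex T P' (fun x => g (u (f x))); last by exists h.
by move=> b x y; rewrite linearP !linearD semilinearZ linearZ.
Qed.

Lemma semilinear_dual (T : lmodType B) (h : {linear T -> B^o}) :
  {h' : {linear T -> C^o | phi \; *:%R} | forall z, h' z = phi (h z)}.
Proof.
apply: (semilinear_ex (P := C^o)) => b x y.
by rewrite linearP rmorphD rmorphM.
Qed.

End LinearMaps.

Lemma linear_of_id (B : comNzRingType) (T P : lmodType B)
    (u : {linear T -> P | idfun \; *:%R}) :
  {g : {linear T -> P} | g =1 u}.
Proof. by apply: linear_ex => b x y; rewrite linearP. Qed.

Lemma linear_to_id (B : comNzRingType) (T P : lmodType B) (u : {linear T -> P}) :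
  {g : {linear T -> P | idfun \; *:%R} | g =1 u}.
Proof. by apply: (semilinear_ex (phi := idfun)) => b x y; rewrite linearP. Qed.

(** Lists of pairs stand for elements of the free module on [X], so that [X] may be any type; later
    it is the algebra [A] itself. *)
Definition lc (B : nzRingType) (T : lmodType B) (X : Type) (g : X -> T)
  (w : seq (B * X)) : T := \sum_(p <- w) p.1 *: g p.2.

Section LinearCombinations.
Variables (B C : comNzRingType) (phi : {rmorphism B -> C}) (X : Type).

Definition wmap (w : seq (B * X)) : seq (C * X) :=
  [seq (phi p.1, p.2) | p <- w].

Definition wscale (b : B) (w : seq (B * X)) : seq (B * X) :=
  [seq (b * p.1, p.2) | p <- w].

Definition generates (T : lmodType B) (g : X -> T) :=
  forall x, exists w, x = lc g w.

Lemma lc_cat (T : lmodType B) (g : X -> T) w1 w2 :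
  lc g (w1 ++ w2) = lc g w1 + lc g w2.
Proof. by rewrite /lc big_cat. Qed.

Lemma lc_scale (T : lmodType B) (g : X -> T) b w :
  lc g (wscale b w) = b *: lc g w.
Proof.
by rewrite /lc big_map scaler_sumr; apply: eq_bigr => p _; rewrite scalerA.
Qed.

Lemma lc1 (T : lmodType B) (g : X -> T) x : lc g [:: (1, x)] = g x.
Proof. by rewrite /lc big_seq1 scale1r. Qed.

Lemma eq_lc (T : lmodType B) (g g' : X -> T) w : g =1 g' -> lc g w = lc g' w.
Proof. by move=> gE; apply: eq_bigr => p _; rewrite gE. Qed.

Lemma lc_sum (T : lmodType B) (J : Type) (r : seq J) (Q : pred J)
    (g : J -> X -> T) w :
  lc (fun x => \sum_(j <- r | Q j) g j x) w = \sum_(j <- r | Q j) lc (g j) w.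
Proof.
rewrite /lc exchange_big; apply: eq_bigr => p _.
by rewrite scaler_sumr.
Qed.

Lemma linear_lc (T P : lmodType B) (g : X -> T) (f : {linear T -> P}) w :
  f (lc g w) = lc (f \o g) w.
Proof. by rewrite linear_sum; apply: eq_bigr => p _; rewrite linearZ. Qed.

Lemma semilinear_lc (T : lmodType B) (P : lmodType C) (g : X -> T)
    (u : {linear T -> P | phi \; *:%R}) w :
  u (lc g w) = lc (u \o g) (wmap w).
Proof.
by rewrite linear_sum /lc big_map; apply: eq_bigr => p _; rewrite semilinearZ.
Qed.

(** Two expressions of one element differ by a relation, so the prescribed value depends only on the
    element; any choice [s] of expressions then defines the map. *)
Lemma semilinear_lift (T : lmodType B) (P : lmodType C) (g : X -> T)
    (f : X -> P) :
  generates g -> (forall w, lc g w = 0 -> lc f (wmap w) = 0) ->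
  {h : {linear T -> P | phi \; *:%R} | forall x, h (g x) = f x}.
Proof.
move=> gg gf.
have wd w w' : lc g w = lc g w' -> lc f (wmap w) = lc f (wmap w').
  move=> E; apply/eqP; rewrite -subr_eq0; apply/eqP.
  rewrite -(gf (w ++ wscale (-1) w')) ?lc_cat ?lc_scale ?E ?scaleN1r ?subrr //.
  rewrite /wmap map_cat /lc big_cat /= !big_map; congr (_ + _); rewrite -sumrN.
  by apply: eq_bigr => p _ /=; rewrite mulN1r rmorphN scaleNr.
pose s x := sval (cid (gg x)).
have sE x : lc g (s x) = x by rewrite /s; case: cid.
have [|h hE] := @semilinear_ex B C phi T P (fun x => lc f (wmap (s x))).
  move=> b x y; rewrite (wd _ (wscale b (s x) ++ s y)); last first.
    by rewrite lc_cat lc_scale !sE.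
  rewrite /wmap map_cat {1}/lc big_cat /= -map_comp; congr (_ + _).
  rewrite /lc !big_map scaler_sumr; apply: eq_bigr => p _ /=.
  by rewrite rmorphM scalerA.
exists h => x; rewrite hE (wd _ [:: (1, x)]); last by rewrite lc1 sE.
by rewrite /wmap /lc /= big_seq1 rmorph1 scale1r.
Qed.

Lemma semilinear_eq (T : lmodType B) (P : lmodType C) (g : X -> T)
    (h h' : {linear T -> P | phi \; *:%R}) :
  generates g -> (forall x, h (g x) = h' (g x)) -> h =1 h'.
Proof.
move=> gg hh' x; have [w ->] := gg x; rewrite !semilinear_lc.
by apply: eq_bigr => p _ /=; rewrite hh'.
Qed.

End LinearCombinations.

Lemma generates_comp (B C : comNzRingType) (phi : {rmorphism B -> C})
    (X : Type) (T : lmodType B) (P : lmodType C) (g : X -> T)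
    (u : {linear T -> P | phi \; *:%R}) :
  generates g -> (forall y, exists w : seq (C * T), y = lc u w) ->
  generates (u \o g).
Proof.
move=> gg uu y; have [w ->] := uu y.
elim: w => [|[c x] w [w' IHw]]; first by exists [::]; rewrite /lc !big_nil.
have [v ->] := gg x; exists (wscale c (wmap phi v) ++ w').
rewrite lc_cat lc_scale -IHw /lc big_cons /=; congr (_ *: _ + _).
exact: semilinear_lc.
Qed.

(** * Quotient modules and base change *)

Section QuotientModule.
Variables (B D : comNzRingType) (pi : {rmorphism B -> D}).
Hypothesis pi_surj : forall d, exists b, pi b = d.

(** The submodule (ker pi) T. *)
Definition ideal_multiple (T : lmodType B) (x : T) : Prop :=
  exists w : seq (B * T), all (fun p => pi p.1 == 0) w /\ x = lc id w.

(** Since [u] kills (ker pi) T by semilinearity, this identifies [T'] with T / (ker pi) T, a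
    concrete model of the base change along [pi]. *)
Definition quotient_map (T : lmodType B) (T' : lmodType D)
    (u : {linear T -> T' | pi \; *:%R}) : Prop :=
  (forall y, exists x, u x = y) /\ (forall x, u x = 0 -> ideal_multiple x).

Lemma quotient_map_lift (C : comNzRingType) (phi : {rmorphism B -> C})
    (psi : {rmorphism D -> C}) (T : lmodType B) (T' : lmodType D)
    (P : lmodType C) (u : {linear T -> T' | pi \; *:%R})
    (h : {linear T -> P | phi \; *:%R}) :
  quotient_map u -> (forall b, psi (pi b) = phi b) ->
  {g : {linear T' -> P | psi \; *:%R} | forall x, g (u x) = h x}.
Proof.
move=> [u_surj u_ker] psiE.
have h0 x : u x = 0 -> h x = 0.
  move=> /u_ker[w [w0 ->]]; rewrite /lc linear_sum big_seq big1 // => p pw.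
  by rewrite semilinearZ -psiE (eqP (allP w0 p pw)) rmorph0 scale0r.
have hE x y : u x = u y -> h x = h y.
  by move=> E; apply/eqP; rewrite -subr_eq0 -linearB h0 // linearB E subrr.
pose s y := sval (cid (u_surj y)).
have sE y : u (s y) = y by rewrite /s; case: cid.
have [|g gE] := @semilinear_ex D C psi T' P (fun y => h (s y)).
  move=> d x y; have [b <-] := pi_surj d; rewrite psiE -semilinearZ -linearD.
  by apply: hE; rewrite linearD semilinearZ !sE.
by exists g => x; rewrite gE; apply: hE; rewrite sE.
Qed.

Lemma quotient_map_base_change (T : lmodType B) (T' : lmodType D)
    (u : {linear T -> T' | pi \; *:%R}) :
  quotient_map u -> is_base_change u.
Proof.
move=> qu P h; split.
  have [|g gE] := quotient_map_lift (phi := pi) (psi := idfun) h qu; first by [].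
  by have [g' g'E] := linear_of_id g; exists g' => x /=; rewrite g'E gE.
by move=> g g' E y; have [x <-] := qu.1 y; exact: E.
Qed.

(** A base change along psi o pi factors through the quotient along [pi]: maps out of [T1] become
    maps out of [T] by composition with [u1], and surjectivity of [u1] brings the factorisation
    back. *)
Lemma quotient_map_factor (C : comNzRingType) (phi : {rmorphism B -> C})
    (psi : {rmorphism D -> C}) (T : lmodType B) (T1 : lmodType D)
    (T2 : lmodType C) (u1 : {linear T -> T1 | pi \; *:%R})
    (u2 : {linear T -> T2 | phi \; *:%R}) :
  (forall b, psi (pi b) = phi b) -> quotient_map u1 -> is_base_change u2 ->
  {v : {linear T1 -> T2 | psi \; *:%R} |
     (forall x, v (u1 x) = u2 x) /\ is_base_change v}.
Proof.
move=> psiE q1 bc2; have [v vE] := quotient_map_lift u2 q1 psiE.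
exists v; split=> // P h.
have [|h' h'E] := @semilinear_ex B C phi T P (fun x => h (u1 x)).
  by move=> b x y; rewrite linearP linearD !semilinearZ psiE.
have [[g gE] gU] := bc2 P h'; split.
  exists g => y /=; have [x <-] := q1.1 y.
  by rewrite vE; have /= -> := gE x; rewrite h'E.
move=> k k' E; apply: gU => x /=; rewrite -vE; exact: E.
Qed.

Lemma ideal_multipleD (T : lmodType B) (x y : T) :
  ideal_multiple x -> ideal_multiple y -> ideal_multiple (x + y).
Proof.
move=> [w [w0 ->]] [w' [w'0 ->]]; exists (w ++ w').
by rewrite all_cat w0 w'0 lc_cat.
Qed.

Lemma ideal_multipleZ (T : lmodType B) b (x : T) :
  ideal_multiple x -> ideal_multiple (b *: x).
Proof.
move=> [w [w0 ->]]; exists (wscale b w); rewrite lc_scale; split=> //.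
rewrite all_map; apply: sub_all w0 => p /= /eqP p0.
by rewrite rmorphM p0 mulr0.
Qed.

Lemma ideal_multiple_ker (T : lmodType B) b (x : T) :
  pi b = 0 -> ideal_multiple (b *: x).
Proof.
by move=> b0; exists [:: (b, x)]; rewrite /= b0 eqxx /lc big_seq1.
Qed.

Lemma quotient_module (T : lmodType B) :
  exists (T' : lmodType D) (u : {linear T -> T' | pi \; *:%R}),
    quotient_map u.
Proof.
pose K : pred T := fun x => `[< ideal_multiple x >].
have KP x : reflect (ideal_multiple x) (x \in K) by exact: asboolP.
have KB : zmod_closed K.
  split=> [|x y /KP Kx /KP Ky]; apply/KP.
    by rewrite -(scale0r 0); apply: ideal_multiple_ker; rewrite rmorph0.
  by rewrite -scaleN1r; apply: ideal_multipleD => //; apply: ideal_multipleZ.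
pose KZ : zmodClosed T := HB.pack K (GRing.isZmodClosed.Build T K KB).
pose Q : zmodType := @Quotient.quot T KZ.
pose p (x : T) : Q := (\pi_(@Quotient.quot T KZ) x)%qT.
have pE x y : (p x = p y) <-> ideal_multiple (x - y).
  have -> : (p x = p y) <-> (x - y \in K).
    rewrite -[x - y \in K]/(x - y \in KZ) Quotient.idealrBE.
    by split=> [/eqP|/eqP].
  by split=> /KP.
have pD x y : p (x + y) = p x + p y by rewrite /p !piE.
have psurj y : exists x, p x = y by exists (repr y); rewrite /p reprK.
pose s y := sval (cid (psurj y)).
have sE y : p (s y) = y by rewrite /s; case: cid.
pose t d := sval (cid (pi_surj d)).
have tE d : pi (t d) = d by rewrite /t; case: cid.
(* [D] acts through arbitrary preimages; [pZ] shows that the choice does not matter, and the module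
   axioms are inherited from [T]. *)
pose sc d y := p (t d *: s y).
have pZ b x : p (b *: x) = sc (pi b) (p x).
  apply/pE; have -> : b *: x - t (pi b) *: s (p x)
      = (b - t (pi b)) *: x + t (pi b) *: (x - s (p x)).
    by rewrite scalerBl scalerBr addrA addrNK.
  apply: ideal_multipleD.
    by apply: ideal_multiple_ker; rewrite rmorphB tE subrr.
  by apply: ideal_multipleZ; apply/pE; rewrite sE.
have scA a b y : sc a (sc b y) = sc (a * b) y.
  have [x <-] := psurj y; rewrite -[a]tE -[b]tE -rmorphM -!pZ.
  by rewrite scalerA.
have sc1 : left_id 1 sc.
  by move=> y; have [x <-] := psurj y; rewrite -(rmorph1 pi) -pZ scale1r.
have scDr : right_distributive sc +%R.
  move=> a y z; have [x <-] := psurj y; have [x' <-] := psurj z.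
  by rewrite -[a]tE -pD -!pZ -pD scalerDr.
have scDl y : {morph sc^~ y : a b / a + b}.
  move=> a b; have [x <-] := psurj y.
  by rewrite -[a]tE -[b]tE -rmorphD -!pZ -pD scalerDl.
pose m := GRing.Zmodule_isLmodule.Build D Q scA sc1 scDr scDl.
pose T' : lmodType D := HB.pack (GRing.Zmodule.sort Q) m.
have [|u uE] := @semilinear_ex B D pi T T' p.
  by move=> b x y; rewrite pD pZ.
exists T', u; split=> [y|x].
  by have [x xE] := psurj y; exists x; rewrite uE.
rewrite uE => p0; rewrite -[x]subr0; apply/pE; rewrite -[p x]/(p x : T').
by rewrite p0 -(uE 0) linear0.
Qed.

End QuotientModule.

(** * Quotient rings and residue fields *)

Definition ideal_pred (B : comNzRingType) (J : B -> Prop) : Prop :=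
  [/\ J 0, forall x y, J x -> J y -> J (x + y) & forall b x, J x -> J (b * x)].

(** Properness of [J] makes the quotient a nonzero ring, as the ring structure requires. *)
Lemma quotient_ring (B : comNzRingType) (J : B -> Prop) :
  ideal_pred J -> ~ J 1 ->
  exists (D : comNzRingType) (pi : {rmorphism B -> D}),
    (forall d, exists b, pi b = d) /\ (forall b, pi b = 0 <-> J b).
Proof.
move=> [J0 JD JM] J1.
pose K : pred B := fun x => `[< J x >].
have KP x : reflect (J x) (x \in K) by exact: asboolP.
have Kid : idealr_closed K.
  split=> [||a x y /KP Jx /KP Jy]; first exact/KP.
    exact/KP.
  by apply/KP/JD => //; apply: JM.
pose I : idealr B := HB.pack K (isIdealr.Build B K Kid).
pose D : comNzRingType := @Quotient.quot B I.
pose pi : {rmorphism B -> D} := (\pi_(@Quotient.quot B I))%qT.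
exists D, pi; split=> [d|b]; first by exists (repr d); exact: reprK.
rewrite -(rmorph0 pi); split=> [/eqP|Jb].
  by rewrite -Quotient.idealrBE subr0 => /KP.
by apply/eqP; rewrite -Quotient.idealrBE subr0; exact/KP.
Qed.

Lemma rmorphism_lift (B D C : comNzRingType) (pi : {rmorphism B -> D})
    (phi : {rmorphism B -> C}) :
  (forall d, exists b, pi b = d) -> (forall b, pi b = 0 -> phi b = 0) ->
  {psi : {rmorphism D -> C} | forall b, psi (pi b) = phi b}.
Proof.
move=> surj ker.
have wd b c : pi b = pi c -> phi b = phi c.
  by move=> E; apply/eqP; rewrite -subr_eq0 -rmorphB ker // rmorphB E subrr.
pose t d := sval (cid (surj d)).
have tE d : pi (t d) = d by rewrite /t; case: cid.
pose f d := phi (t d).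
have fE b : f (pi b) = phi b by apply: wd; rewrite tE.
have fB : zmod_morphism f.
  move=> x y; rewrite -[x]tE -[y]tE -rmorphB !fE; exact: rmorphB.
have fM : monoid_morphism f.
  split=> [|x y]; first by rewrite -(rmorph1 pi) fE rmorph1.
  by rewrite -[x]tE -[y]tE -rmorphM !fE rmorphM.
pose psi : {rmorphism D -> C} := HB.pack f
  (GRing.isZmodMorphism.Build D C f fB) (GRing.isMonoidMorphism.Build D C f fM).
by exists psi.
Qed.

Section QuotientAlgebra.
Variables (k : fieldType) (B : comAlgType k).

Lemma quotient_algebra (J : B -> Prop) : ideal_pred J -> ~ J 1 ->
  exists (D : comAlgType k) (pi : {lrmorphism B -> D}),
    (forall d, exists b, pi b = d) /\ (forall b, pi b = 0 <-> J b).
Proof.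
move=> Jid J1; have [D0 [p [psurj pker]]] := quotient_ring Jid J1.
pose sc (c : k) (d : D0) := p c%:A * d.
have scA a b d : sc a (sc b d) = sc (a * b) d.
  by rewrite /sc mulrA -rmorphM -scalerAl mul1r scalerA.
have sc1 : left_id 1 sc by move=> d; rewrite /sc scale1r rmorph1 mul1r.
have scDr : right_distributive sc +%R by move=> a x y; rewrite /sc mulrDr.
have scDl x : {morph sc^~ x : a b / a + b}.
  by move=> a b; rewrite /sc scalerDl rmorphD mulrDl.
pose m := GRing.Zmodule_isLmodule.Build k D0 scA sc1 scDr scDl.
have scAl c (x y : D0) : sc c (x * y) = sc c x * y by exact: mulrA.
have scAr c (x y : D0) : sc c (x * y) = x * sc c y by exact: mulrCA.
pose L : GRing.LSemiModule.type k := HB.pack (GRing.ComNzRing.sort D0) m.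
pose l := GRing.LSemiModule_isLSemiAlgebra.Build k L scAl.
pose LA : lalgType k := HB.pack (GRing.ComNzRing.sort D0) m l.
pose r := GRing.LSemiAlgebra_isSemiAlgebra.Build k LA scAr.
pose D : comAlgType k := HB.pack (GRing.ComNzRing.sort D0) m l r.
have pL : scalable (p : B -> D).
  by move=> c x; rewrite -[c *: (p x : D)]/(p c%:A * p x) -rmorphM -scalerAl mul1r.
pose p' : {rmorphism B -> D} := p.
pose pi : {lrmorphism B -> D} := HB.pack (p' : B -> D) p'
  (GRing.isScalable.Build k B D *:%R p' pL).
by exists D, pi.
Qed.

Lemma lrmorphism_lift (D C : comAlgType k) (pi : {lrmorphism B -> D})
    (phi : {lrmorphism B -> C}) :
  (forall d, exists b, pi b = d) -> (forall b, pi b = 0 -> phi b = 0) ->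
  {psi : {lrmorphism D -> C} | forall b, psi (pi b) = phi b}.
Proof.
move=> surj ker; have [psi psiE] := rmorphism_lift surj ker.
have psiL : scalable psi.
  by move=> c d; have [b <-] := surj d; rewrite -[c *: pi b]linearZ_LR !psiE;
    exact: (linearZ_LR phi).
pose psi' : {lrmorphism D -> C} := HB.pack (psi : D -> C) psi
  (GRing.isScalable.Build k D C *:%R psi psiL).
by exists psi'.
Qed.

End QuotientAlgebra.

(** The residue field of a maximal ideal above [J]. It shows that an ideal is the unit ideal by a
    contradiction at a point of Spec B. *)
Lemma max_ideal_field (B : comNzRingType) (J : B -> Prop) :
  ideal_pred J -> ~ J 1 ->
  exists (F : fieldType) (phi : {rmorphism B -> F}),
    (forall c, exists b, phi b = c) /\ (forall b, J b -> phi b = 0).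
Proof.
move=> [J0 JD JM] J1.
pose I := {K : B -> Prop | [/\ ideal_pred K, ~ K 1 & forall b, J b -> K b]}.
pose R (K L : I) := `[< forall b, sval K b -> sval L b >].
have [|||A Atot|M Mmax] := @classical_sets.Zorn I R.
- by move=> K; apply/asboolP.
- by move=> K L N /asboolP KL /asboolP LN; apply/asboolP => b /KL /LN.
- move=> [K PK] [L PL] /asboolP /= KL /asboolP /= LK; apply: eq_exist.
  by apply: funext => b; apply: propext; split; [exact: KL|exact: LK].
- have [[K0 AK0]|A0] := lem (exists K, A K); last first.
    (* The union of an empty chain would be empty; [J] itself bounds that chain. *)
    have PJ : [/\ ideal_pred J, ~ J 1 & forall b, J b -> J b] by [].
    by exists (exist _ J PJ) => K AK; case: A0; exists K.
  pose U b := exists K, A K /\ sval K b.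
  have PU : [/\ ideal_pred U, ~ U 1 & forall b, J b -> U b].
    split=> [|[K [_]]|b Jb]; last by exists K0; split=> //; have [_ _] := svalP K0; exact.
      split=> [|x y [K [AK Kx]] [L [AL Ly]]|b x [K [AK Kx]]].
      + by exists K0; split=> //; have [[]] := svalP K0.
      + have [/asboolP KL|/asboolP LK] := Atot _ _ AK AL.
          exists L; split=> //; have [[_ LD _] _ _] := svalP L.
          by apply: LD => //; exact: KL.
        exists K; split=> //; have [[_ KD _] _ _] := svalP K.
        by apply: KD => //; exact: LK.
      + by exists K; split=> //; have [[_ _ KM] _ _] := svalP K; exact: KM.
    by have [_ K1 _] := svalP K => /K1.
  exists (exist _ U PU) => K AK; apply/asboolP => b Kb /=; by exists K.
have [Mid M1 JM'] := svalP M; set m := sval M in Mid M1 JM'.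
have [D [p [psurj pker]]] := quotient_ring Mid M1.
have inv_ex (x : D) : exists y : D, (x = 0 -> y = 0) /\ (x != 0 -> y * x = 1).
  have [->|x0] := eqVneq x 0; first by exists 0; split.
  have [b bx] := psurj x; have [m0 mD mM] := Mid.
  (* [N] is the ideal generated by [m] and [b]: either it contains 1, which inverts [b] modulo [m],
     or maximality gives N = m and x = 0. *)
  pose N c := exists a r, m a /\ c = a + r * b.
  have Nid : ideal_pred N.
    split=> [|_ _ [a [r [ma ->]]] [a' [r' [ma' ->]]]|c _ [a [r [ma ->]]]].
    - by exists 0, 0; rewrite mul0r addr0.
    - by exists (a + a'), (r + r'); rewrite mulrDl addrACA; split=> //; exact: mD.
    - by exists (c * a), (c * r); rewrite mulrDr mulrA; split=> //; exact: mM.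
  have mN c : m c -> N c by exists c, 0; rewrite mul0r addr0.
  have [[a [r [ma E]]]|N1] := lem (N 1).
    exists (p r); split=> [x00|_]; first by rewrite x00 eqxx in x0.
    rewrite -bx -rmorphM -(rmorph1 p) E rmorphD.
    by rewrite (proj2 (pker a) ma) add0r.
  have PN : [/\ ideal_pred N, ~ N 1 & forall c, J c -> N c].
    by split=> // c Jc; apply/mN/JM'.
  have NM : exist _ N PN = M by apply: Mmax; exact/asboolP.
  case/eqP: x0; rewrite -bx; apply/pker; rewrite /m -NM /=.
  by exists 0, 1; rewrite mul1r add0r.
pose inv x := sval (cid (inv_ex x)).
have mulVf (x : D) : x != 0 -> inv x * x = 1.
  by rewrite /inv; case: cid => y /= [].
have inv0 : inv 0 = 0 by rewrite /inv; case: cid => y /= [->].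
pose F : fieldType := HB.pack (GRing.ComNzRing.sort D)
  (GRing.ComNzRing_isField.Build D mulVf inv0).
exists F, p; split=> // b Jb; apply/pker; exact: JM'.
Qed.


(** * Finite projectivity of locally free modules *)

(** Otherwise a residue field above [J] would kill every [f i], hence 1. This globalises statements
    that hold on each chart up to a power of [f i]. *)
Lemma partition_unity (B : comNzRingType) m (f g : 'I_m -> B) (J : B -> Prop) :
  \sum_i g i * f i = 1 -> ideal_pred J -> (forall i, exists N, J (f i ^+ N)) ->
  J 1.
Proof.
move=> fg Jid Jf; have [//|J1] := lem (J 1).
have [F [phi [_ phi0]]] := max_ideal_field Jid J1.
have /eqP[] : (1 : F) != 0 := oner_neq0 _.
rewrite -(rmorph1 phi) -fg rmorph_sum big1 // => i _; rewrite rmorphM.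
have [N /phi0] := Jf i; rewrite rmorphXn => /eqP; rewrite expf_eq0 => /andP[_].
by move=> /eqP ->; rewrite mulr0.
Qed.

Section DualBasis.
Variables (B : comNzRingType) (T : lmodType B) (S : T -> Prop).
Variables (e : {linear T -> T}) (r : nat).
Hypotheses (SP : forall x, S x <-> e x = x) (ee : forall x, e (e x) = e x).

Let S_lc (J : finType) (x : J -> T) c :
  (forall j, S (x j)) -> S (\sum_j c j *: x j).
Proof.
move=> Sx; apply/SP; rewrite linear_sum; apply: eq_bigr => j _.
by rewrite linearZ /= (proj1 (SP _) (Sx j)).
Qed.

(** A functional on [S] is a function on finitely many generators [x q] that kills their relations.
    The coordinates on a chart [a], multiplied by a power of [f a], do so, and they expand the
    multiples of all elements by some power of [f a]. The scalars whose multiples admit such an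
    expansion form an ideal, so 1 is among them. *)
Lemma locally_free_dual_basis : locally_free S r ->
  exists w : seq ({linear T -> B^o} * T),
    forall z, S z -> z = \sum_(p <- w) p.1 z *: p.2.
Proof.
move=> [m [f [g [fg loc]]]].
have /choice[t tP] := loc.
have tS a l : S (t a l) by have [] := tP a.
have tgen a x : S x -> exists N (c : 'I_r -> B), f a ^+ N *: x = \sum_j c j *: t a j.
  by have [_ + _] := tP a; apply.
have tfree a (c : 'I_r -> B) : \sum_j c j *: t a j = 0 ->
    exists N, forall j, f a ^+ N * c j = 0 by have [_ _] := tP a; apply.
pose x (q : 'I_m * 'I_r) := t q.1 q.2.
have Sx q : S (x q) by exact: tS.
have xgen z : S z -> exists c : 'I_m * 'I_r -> B, z = \sum_q c q *: x q.
  move=> Sz; pose J b := exists c : 'I_m * 'I_r -> B, b *: z = \sum_q c q *: x q.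
  suff [c] : J 1 by rewrite scale1r => ->; exists c.
  apply: partition_unity fg _ _.
    split=> [|b b' [c E] [c' E']|b b' [c E]].
    - exists (fun=> 0); rewrite scale0r big1 // => q _; exact: scale0r.
    - exists (fun q => c q + c' q); rewrite scalerDl E E' -big_split.
      by apply: eq_bigr => q _; rewrite scalerDl.
    - exists (fun q => b * c q); rewrite -scalerA E scaler_sumr.
      by apply: eq_bigr => q _; rewrite scalerA.
  move=> a; have [N [c E]] := tgen a z Sz; exists N.
  exists (fun q => if q.1 == a then c q.2 else 0); rewrite E.
  rewrite -(pair_bigA _ (fun i j => (if i == a then c j else 0) *: t i j)) /=.
  rewrite (bigD1 a) //= eqxx [X in _ + X]big1 ?addr0 // => i /negbTE ->.
  by rewrite big1 // => j _; rewrite scale0r.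
have [M Mx] : exists M : 'I_m -> nat, forall a, exists c : 'I_m * 'I_r -> 'I_r -> B,
    forall q, f a ^+ M a *: x q = \sum_l c q l *: t a l.
  suff /choice[M MP] : forall a, exists N, exists c : 'I_m * 'I_r -> 'I_r -> B,
    forall q, f a ^+ N *: x q = \sum_l c q l *: t a l by exists M.
  move=> a; have /choice[N] := fun q => tgen a (x q) (Sx q).
  move=> /choice[c cE]; exists (\max_q N q)%N.
  exists (fun q l => f a ^+ (\max_q N q - N q) * c q l) => q.
  rewrite -(subnK (leq_bigmax q : N q <= \max_q N q)%N) exprD -scalerA cE.
  rewrite scaler_sumr addnK; apply: eq_bigr => l _; exact: scalerA.
have /choice[c cE] := Mx.
(* Independently of the chart, a functional on S is a function on the indices
   killing the relations f^M e_q - sum_l c_ql e_(b,l). *)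
have ext (d : 'I_m * 'I_r -> B) :
    (forall b q, f b ^+ M b * d q = \sum_l c b q l * d (b, l)) ->
    forall s : 'I_m * 'I_r -> B, \sum_q s q *: x q = 0 -> \sum_q s q * d q = 0.
  move=> dE s s0; set y := \sum_q _; rewrite -[y]mul1r.
  pose J b := b * y = 0; change (J 1); apply: partition_unity fg _ _.
    split=> [|b b' E E'|b b' E]; rewrite /J ?mul0r // ?mulrDl ?E ?E' ?addr0 //.
    by rewrite -mulrA E mulr0.
  move=> b.
  have [N N0] : exists N, forall l, f b ^+ N * (\sum_q s q * c b q l) = 0.
    apply: tfree; transitivity (f b ^+ M b *: \sum_q s q *: x q).
      rewrite scaler_sumr (eq_bigr (fun l => \sum_q (s q * c b q l) *: t b l)).
        rewrite exchange_big; apply: eq_bigr => q _ /=.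
        rewrite scalerA mulrC -scalerA cE scaler_sumr.
        by apply: eq_bigr => l _; rewrite scalerA.
      by move=> l _; rewrite scaler_suml.
    by rewrite s0 scaler0.
  exists (N + M b)%N; rewrite /J exprD -mulrA /y mulr_sumr.
  under eq_bigr do rewrite mulrCA dE mulr_sumr.
  rewrite exchange_big mulr_sumr big1 // => l _ /=.
  under eq_bigr do rewrite mulrA.
  by rewrite -mulr_suml mulrA N0 mul0r.
pose J b := exists w : seq ({linear T -> B^o} * T),
  forall z, S z -> b *: z = \sum_(p <- w) p.1 z *: p.2.
suff [w wE] : J 1 by exists w => z /wE <-; rewrite scale1r.
apply: partition_unity fg _ _.
  split=> [|b b' [w E] [w' E']|b b' [w E]].
  - by exists [::] => z _; rewrite big_nil scale0r.
  - by exists (w ++ w') => z Sz; rewrite big_cat scalerDl -E // -E'.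
  - exists [seq (p.1, b *: p.2) | p <- w] => z Sz; rewrite big_map -scalerA E //.
    by rewrite scaler_sumr; apply: eq_bigr => p _; rewrite !scalerA mulrC.
move=> a.
(* [t a] is independent only after inverting [f a], so the coordinates [c a] respect the transition
   relations of the charts [b] only up to a power of [f a]; [N] is uniform in all indices. *)
have [N NE] : exists N, forall b q l0,
    f a ^+ N * (f b ^+ M b * c a q l0 - \sum_l c b q l * c a (b, l) l0) = 0.
  have /choice[N NE] : forall bq : 'I_m * ('I_m * 'I_r), exists N, forall l0,
      f a ^+ N * (f bq.1 ^+ M bq.1 * c a bq.2 l0
        - \sum_l c bq.1 bq.2 l * c a (bq.1, l) l0) = 0.
    move=> [b q] /=; apply: tfree.
    under eq_bigr do rewrite scalerBl -scalerA scaler_suml.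
    rewrite sumrB -scaler_sumr -cE exchange_big /=.
    under [X in _ - X]eq_bigr do under eq_bigr do rewrite -scalerA.
    under [X in _ - X]eq_bigr do rewrite -scaler_sumr -cE scalerA mulrC -scalerA.
    by rewrite -scaler_sumr -cE scalerA mulrC -scalerA subrr.
  exists (\max_bq N bq)%N => b q l0.
  rewrite -(subnK (leq_bigmax (b, q) : N (b, q) <= \max_bq N bq)%N) exprD -mulrA.
  by rewrite (NE (b, q)) mulr0.
have Se z : S (e z) by apply/SP.
pose s z := sval (cid (xgen _ (Se z))).
have sE z : e z = \sum_q s z q *: x q by rewrite /s; case: cid.
have lamE l0 : exists lam : {linear T -> B^o},
    forall z, lam z = \sum_q s z q * (f a ^+ N * c a q l0).
  have [|lam lamE] := @linear_ex B T B^o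
    (fun z => \sum_q s z q * (f a ^+ N * c a q l0)); last by exists lam.
  (* The chosen coefficients [s z] are linear in [z] only up to a relation among the [x q], and
     [ext] kills such relations. *)
  move=> b z z'; apply/eqP; rewrite -subr_eq0; apply/eqP.
  transitivity (\sum_q (s (b *: z + z') q - (b * s z q + s z' q))
                          * (f a ^+ N * c a q l0)).
    rewrite scaler_sumr -big_split -sumrB; apply: eq_bigr => q _ /=.
    by rewrite mulrBl mulrDl -[b * _ * _]mulrA.
  apply: ext => [b' q|].
    apply/eqP; rewrite mulrCA -subr_eq0.
    have -> : \sum_l c b' q l * (f a ^+ N * c a (b', l) l0)
            = f a ^+ N * \sum_l c b' q l * c a (b', l) l0.
      by rewrite mulr_sumr; apply: eq_bigr => l _; rewrite mulrCA.
    by rewrite -mulrBr NE.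
  under eq_bigr do rewrite scalerBl scalerDl -scalerA.
  by rewrite sumrB big_split -scaler_sumr -!sE linearP subrr.
have /choice[lam lamP] := lamE.
(* The factor [f a ^+ N] is part of [lam]; the factor [f a ^+ M a] expands the generators [x q] in
   the basis [t a]. *)
exists (N + M a)%N, [seq (lam l, t a l) | l <- enum 'I_r] => z Sz.
rewrite big_map big_enum /=.
under eq_bigr do rewrite lamP scaler_suml.
rewrite exchange_big /= -[in LHS](proj1 (SP z) Sz) sE scaler_sumr.
apply: eq_bigr => q _; rewrite scalerA mulrC exprD -!scalerA cE !scaler_sumr.
by apply: eq_bigr => l _; rewrite !scalerA mulrA.
Qed.

End DualBasis.

(** * Stability and generation by the root section *)

Section RepTheory.
Variables (k : fieldType) (A : vertex_algebra k).

Section OneRep.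
Variables (B : comAlgType k) (T : rep A B).
Local Notation act := (rep_act T).
Local Notation e := (@va_idem k A).

Lemma rep_actD a b x : act (a + b) x = act a x + act b x.
Proof. by have := rep_actP 1 a b x; rewrite !scale1r. Qed.

Lemma rep_act0 x : act 0 x = 0.
Proof. by apply: (addrI (act 0 x)); rewrite -rep_actD !addr0. Qed.

Lemma rep_act_sum (J : Type) (r : seq J) (Q : pred J) (F : J -> A) x :
  act (\sum_(j <- r | Q j) F j) x = \sum_(j <- r | Q j) act (F j) x.
Proof.
by elim/big_rec2: _ => [|j y a _ <-]; rewrite ?rep_act0 ?rep_actD.
Qed.

Lemma rep_vert_sum x : x = \sum_i act (e i) x.
Proof. by rewrite -rep_act_sum va_sum rep_act1. Qed.

Lemma rep_vert_orth i j x :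
  act (e i) (act (e j) x) = if i == j then act (e i) x else 0.
Proof. by rewrite -rep_actM va_orth; case: eqP; rewrite ?rep_act0. Qed.

Lemma rep_vertE i x : rep_vert (T := T) i x <-> act (e i) x = x.
Proof. by []. Qed.

Lemma rep_vert_proj i x : rep_vert (T := T) i (act (e i) x).
Proof. by rewrite /rep_vert rep_vert_orth eqxx. Qed.

Definition is_root (t : T) : Prop :=
  rep_vert (T := T) (va_root A) t /\
  forall x, rep_vert (T := T) (va_root A) x -> exists! b : B, x = b *: t.

Definition orb (t : T) (a : A) : T := act a t.

(** The coordinate of the root line, extended to all of [T] through the projection by the root
    idempotent. Being a functional on [T], it can be base-changed. *)
Lemma root_coord t : is_root t ->
  exists h : {linear T -> B^o}, h t = 1 /\
    forall x, act (e (va_root A)) x = h x *: t.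
Proof.
move=> [t0 tU].
have inj b c : b *: t = c *: t -> b = c.
  move=> E; have [|d [_ dU]] := tU (b *: t).
    by rewrite /rep_vert linearZ /= t0.
  by rewrite -(dU b) // -(dU c).
pose s x := sval (cid (tU _ (rep_vert_proj (va_root A) x))).
have sE x : act (e (va_root A)) x = s x *: t by rewrite /s; case: cid => c [].
have [|h hE] := @linear_ex B T B^o s.
  by move=> b x y; apply: inj; rewrite -sE linearP !sE scalerDl scalerA.
exists h; split=> [|x]; rewrite hE //.
by apply: inj; rewrite -sE t0 scale1r.
Qed.

Lemma lc_orb_act (t : T) a w :
  act a (lc (orb t) w) = lc (fun b => act (a * b) t) w.
Proof.
rewrite linear_lc; apply: eq_lc => b; exact/esym/rep_actM.
Qed.

End OneRep.

Lemma base_change_ext (B C : comNzRingType) (phi : {rmorphism B -> C})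
    (T : lmodType B) (T' P : lmodType C)
    (u : {linear T -> T' | phi \; *:%R}) (g g' : {linear T' -> P}) :
  is_base_change u -> (forall x, g (u x) = g' (u x)) -> g =1 g'.
Proof.
move=> bc E.
have [|h hE] := @semilinear_ex B C phi T P (g \o u).
  by move=> b x y /=; rewrite !linearD semilinearZ linearZ.
by have [_ gU] := bc P h; exact: gU.
Qed.

Lemma lker_projC (F : fieldType) (M : vectType F) (N : {vspace M}) :
  exists p : 'End(M), forall y, (p y == 0) = (y \in N).
Proof.
exists (\1 - projv N)%VF => y; rewrite add_lfunE opp_lfunE id_lfunE subr_eq0.
by apply/eqP/idP => [->|yN]; [exact: memv_proj | rewrite projv_id].
Qed.

(** Membership in [N] is the vanishing of a linear map, so the uniqueness clause of base change
    reduces it to the image of [u]. *)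
Lemma base_change_mem (B : comNzRingType) (F : fieldType)
    (phi : {rmorphism B -> F}) (T : lmodType B) (M : vectType F)
    (u : {linear T -> M | phi \; *:%R}) (f : 'End(M)) (N : {vspace M}) :
  is_base_change u -> (forall x, f (u x) \in N) -> forall y, f y \in N.
Proof.
move=> bc uN y; have [p pE] := lker_projC N; rewrite -pE.
have [g gE] : exists g : {linear M -> M}, forall y, g y = p (f y).
  by have [|g gE] := @linear_ex F M M (fun y => p (f y));
    [move=> b x z; rewrite !linearP | exists g].
have [z zE] : exists z : {linear M -> M}, forall y, z y = 0.
  by have [|g' g'E] := @linear_ex F M M (fun=> 0);
    [move=> b x z; rewrite scaler0 addr0 | exists g'].
rewrite -gE (base_change_ext (g' := z) bc) ?zE // => x.
by rewrite gE zE; apply/eqP; rewrite pE.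
Qed.

(** The vector [u t] spans the root line of the fibre and generates the fibre. A proper submodule
    cannot contain it, so it vanishes at the root and only the positive weights contribute. *)
Lemma stable_of_generated (B : comAlgType k) (T : rep A B) (t : T)
    (theta : va_vert A -> rat) :
  (forall i, i != va_root A -> 0 < theta i) ->
  is_root t -> generates (orb t) -> stable_fibres theta T.
Proof.
move=> theta_gt0 troot gen F phi M u act bc uact N Nsub N0 Nfull.
have [h [_ hE]] := root_coord troot.
set o := va_root A in theta_gt0 hE.
have full_of_t : u t \in N -> False.
  move=> tN; case/eqP: Nfull; apply/eqP; rewrite eqEsubv subvf /=.
  apply/subvP => y _.
  have := base_change_mem (f := \1%VF) (N := N) bc; rewrite -[y in y \in _]id_lfunE.
  apply=> x; rewrite id_lfunE; have [w ->] := gen x.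
  rewrite semilinear_lc /lc big_map rpred_sum // => p _ /=; apply: rpredZ.
  by rewrite -uact; apply: (subvP (Nsub p.2)); exact: memv_img.
have e_sum (y : M) : y = \sum_i act (va_idem i) y.
  have [g gE] : exists g : {linear M -> M},
      forall y, g y = \sum_i act (va_idem i) y.
    have [|g gE] := @linear_ex F M M (fun y => \sum_i act (va_idem i) y).
      by move=> b x z; rewrite scaler_sumr -big_split; apply: eq_bigr => i _;
        rewrite linearP.
    by exists g.
  have [g' g'E] : exists g' : {linear M -> M}, forall y, g' y = y.
    by have [|g' g'E] := @linear_ex F M M id => //; exists g'.
  rewrite -gE -[LHS]g'E; apply: (base_change_ext bc) => x.
  rewrite gE g'E [in LHS](rep_vert_sum x) linear_sum.
  by apply: eq_bigr => i _; rewrite uact.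
have M0 y : act (va_idem o) y \in <[u t]>%VS.
  apply: (base_change_mem bc) => x; rewrite uact hE semilinearZ.
  by rewrite rpredZ // memv_line.
have N00 : (act (va_idem o) @: N)%VS = 0%VS.
  apply/eqP; rewrite -subv0; apply/subvP => _ /memv_imgP[y yN ->].
  have /vlineP[c cE] := M0 y; rewrite memv0 cE.
  have [->|c0] := eqVneq c 0; first by rewrite scale0r.
  case: full_of_t; rewrite -[u t]scale1r -(mulVf c0) -scalerA -cE rpredZ //.
  by apply: (subvP (Nsub _)); exact: memv_img.
have /existsP[i Ni0] : [exists i, (act (va_idem i) @: N)%VS != 0%VS].
  apply: contraNT N0; rewrite negb_exists => /forallP Ni0.
  rewrite -subv0; apply/subvP => y yN; rewrite memv0 (e_sum y) big1 // => i _.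
  have := Ni0 i; rewrite negbK => /eqP E.
  by apply/eqP; rewrite -memv0 -E memv_img.
have oi : i != o by apply: contraNneq Ni0 => ->; rewrite N00.
rewrite /theta_dim (bigD1 i) //= ltr_wpDr //; last first.
  by rewrite mulr_gt0 ?theta_gt0 // ltr0n lt0n dimv_eq0.
apply: sumr_ge0 => j _; have [->|oj] := eqVneq j o.
  by rewrite N00 dimv0 mulr0.
by rewrite mulr_ge0 // ltW // theta_gt0.
Qed.

End RepTheory.

(** Stability of fibres is phrased for [vectType], whereas a fibre arises as a bare module; dropping
    dependent generators one by one identifies it with a row space. *)
Lemma spanned_row_iso (F : fieldType) (V : lmodType F) p (x : 'I_p -> V) :
  (forall y, exists c : 'I_p -> F, y = \sum_i c i *: x i) ->
  exists n (f : {linear V -> 'rV[F]_n}), bijective f.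
Proof.
elim: p x => [|p IHp] x xV.
  exists 0%N; have [f fE] : {f : {linear V -> 'rV[F]_0} | forall y, f y = 0}.
    by apply: linear_ex => b y z; rewrite scaler0 addr0.
  exists f; exists (fun=> 0) => [y|r]; last by rewrite [r]thinmx0 fE.
  by have [c ->] := xV y; rewrite big_ord0.
have [indep|dep] :=
    lem (forall c : 'I_p.+1 -> F, \sum_i c i *: x i = 0 -> forall i, c i = 0).
  have /choice[c cE] := xV.
  have cU y d : y = \sum_i d i *: x i -> forall i, c y i = d i.
    move=> E i; apply/eqP; rewrite -subr_eq0; apply/eqP.
    apply: (indep (fun i => c y i - d i)).
    by under eq_bigr do rewrite scalerBl; rewrite sumrB -cE -E subrr.
  have [f fE] : {f : {linear V -> 'rV[F]_p.+1} | forall y, f y = \row_i c y i}.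
    apply: linear_ex => b y z; apply/rowP => i; rewrite !mxE.
    apply: (cU _ (fun i => b * c y i + c z i)).
    under eq_bigr do rewrite scalerDl -scalerA.
    by rewrite big_split -scaler_sumr -!cE.
  exists p.+1, f; exists (fun r : 'rV_p.+1 => \sum_i r 0 i *: x i) => [y|r].
    by rewrite fE; under eq_bigr do rewrite mxE; rewrite -cE.
  by rewrite fE; apply/rowP => i; rewrite mxE; exact: (cU _ (r 0)).
have {dep}[c [c0 [i ci]]] : exists c : 'I_p.+1 -> F,
    \sum_i c i *: x i = 0 /\ exists i, c i != 0.
  have [//|H] := lem (exists c : 'I_p.+1 -> F,
    \sum_i c i *: x i = 0 /\ exists i, c i != 0).
  case: dep => c c0 i; apply/eqP/negPn/negP => ci; apply: H.
  by exists c; split=> //; exists i.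
apply: (IHp (x \o lift i)) => y; have [d ->] := xV y.
exists (fun j => d (lift i j) - d i / c i * c (lift i j)).
move: c0; rewrite !(bigD1_ord i) //= => /eqP; rewrite addr_eq0 => /eqP xi.
have -> : x i = - ((c i)^-1 *: \sum_j c (lift i j) *: x (lift i j)).
  by rewrite -scalerN -xi scalerA mulVf // scale1r.
under [RHS]eq_bigr do rewrite scalerBl.
rewrite sumrB addrC scalerN scalerA scaler_sumr; congr (_ - _).
by apply: eq_bigr => j _; rewrite scalerA.
Qed.

(** [X] may be infinite, so a finite spanning part is grown one element at a time: each new element
    raises the dimension, and [d] bounds how often this happens. *)
Lemma span_family (F : fieldType) (M : vectType F) (X : Type) (g : X -> M) :
  exists N : {vspace M},
    (forall x, g x \in N) /\ (forall y, y \in N -> exists w, y = lc g w).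
Proof.
pose sp s : {vspace M} := (<<[seq g x | x <- s]>>)%VS.
have spE s y : y \in sp s -> exists w, y = lc g w.
  set gs := [seq g x | x <- s] => ys.
  rewrite (@coord_span _ _ _ (in_tuple gs) y ys) /=.
  have /choice[h hE] : forall i : 'I_(size gs), exists x, gs`_i = g x.
    move=> [i /=]; rewrite size_map /gs; case: (s) => // a s' lti.
    by exists (nth a (a :: s') i); rewrite (nth_map a).
  exists [seq (coord (in_tuple gs) i y, h i) | i <- enum 'I_(size gs)].
  by rewrite /lc big_map big_enum; apply: eq_bigr => i _; rewrite hE.
have main d s : (\dim {:M} <= d + \dim (sp s))%N -> exists s, forall x, g x \in sp s.
  elim: d s => [|d IHd] s dM.
    exists s => x; have /eqP -> : sp s == fullv; last exact: memvf.
    by rewrite eqEdim subvf.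
  have [all|nall] := lem (forall x, g x \in sp s); first by exists s.
  have [x xN] : exists x, g x \notin sp s.
    have [//|H] := lem (exists x, g x \notin sp s); case: nall => x.
    by apply/negPn/negP => xN; apply: H; exists x.
  apply: (IHd (x :: s)); rewrite addSnnS in dM; apply: leq_trans dM _.
  rewrite leq_add2l; apply: (@leq_ltn_trans (\dim (sp s))) => //.
  rewrite ltnNge; apply: contra xN => le.
  have : sp s == sp (x :: s) by rewrite eqEdim le /sp /= span_cons addvSr.
  by move/eqP->; rewrite /sp /= memv_span // mem_head.
have [s sE] := main (\dim {:M}) [::] (leq_addr _ _).
by exists (sp s); split=> // y; exact: spE.
Qed.

(** * Generation of stable families by the root section *)

Section Generation.
Variables (k : fieldType) (A : vertex_algebra k).
Variables (v : va_vert A -> nat) (theta : va_vert A -> rat).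

(** A dual basis of e_i T expands only elements of e_i T. Precomposed with e_i, its functionals
    expand e_i z for every [z], and these pieces sum to [z]. *)
Lemma family_dual_basis (B : comAlgType k) (T : rep A B) :
  (forall i, locally_free (rep_vert (T := T) i) (v i)) ->
  exists w : seq ({linear T -> B^o} * T), forall z, z = \sum_(p <- w) p.1 z *: p.2.
Proof.
move=> lf.
have dual i : exists w : seq ({linear T -> B^o} * T),
    forall z, rep_act T (va_idem i) z = \sum_(p <- w) p.1 z *: p.2.
  have [||w wE] := locally_free_dual_basis (e := rep_act T (va_idem i)) _ _ (lf i).
  - by move=> x; exact: rep_vertE.
  - by move=> x; rewrite rep_vert_orth eqxx.
  have [F FE] : exists F : {linear T -> B^o} -> {linear T -> B^o},
      forall h z, F h z = h (rep_act T (va_idem i) z).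
    have /choice[F FE] : forall h : {linear T -> B^o}, exists h' : {linear T -> B^o},
        forall z, h' z = h (rep_act T (va_idem i) z).
      move=> h; have [|h' hE] := @linear_ex B T B^o (fun z => h (rep_act T (va_idem i) z)).
        by move=> b x y; rewrite !linearP.
      by exists h'.
    by exists F.
  exists [seq (F p.1, p.2) | p <- w] => z; rewrite big_map /=.
  by under eq_bigr do rewrite FE; apply: wE; exact: rep_vert_proj.
have /choice[w wE] := dual.
exists (flatten [seq w i | i <- enum (va_vert A)]) => z.
by rewrite big_flatten big_map big_enum /= [LHS]rep_vert_sum; apply: eq_bigr.
Qed.

Lemma rep_fg (B : comAlgType k) (T : rep A B) :
  (forall i, locally_free (rep_vert (T := T) i) (v i)) ->
  exists p (x : 'I_p -> T), forall z, exists c : 'I_p -> B, z = \sum_i c i *: x i.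
Proof.
move=> /family_dual_basis[w wE]; exists (size w), (fun i => (tnth (in_tuple w) i).2).
move=> z; exists (fun i => (tnth (in_tuple w) i).1 z).
by rewrite {1}(wE z) big_tnth.
Qed.

(** Work at the residue field of a maximal ideal above the annihilator [J] of T / G. The image of
    [G] in the fibre has dimension at most v_i at each vertex and exactly v_0 = 1 at the root, so
    its weight is at most theta(v) = 0 and stability forces it to be the whole fibre. Nakayama then
    produces an element of [J] outside the maximal ideal. *)
Lemma generated_of_stable (B : comAlgType k) (T : rep A B) (t : T) :
  v (va_root A) = 1%N -> \sum_i theta i * (v i)%:R = 0 ->
  (forall i, i != va_root A -> 0 < theta i) ->
  (forall i, locally_free (rep_vert (T := T) i) (v i)) ->
  stable_fibres theta T -> is_root t -> generates (orb t).
Proof.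
move=> v_root theta_v theta_gt0 lf st troot.
have [p [x xE]] := rep_fg lf.
pose G z := exists w, z = lc (orb t) w.
have GD z z' : G z -> G z' -> G (z + z').
  by move=> [w ->] [w' ->]; exists (w ++ w'); rewrite lc_cat.
have GZ b z : G z -> G (b *: z).
  by move=> [w ->]; exists (wscale b w); rewrite lc_scale.
have G0 : G 0 by exists [::]; rewrite /lc big_nil.
have Gsum n (F : 'I_n -> T) : (forall i, G (F i)) -> G (\sum_i F i).
  by move=> GF; elim/big_rec: _ => // i z _; exact: GD.
pose J b := forall z, G (b *: z).
suff J1 : J 1 by move=> z; have := J1 z; rewrite scale1r.
have Jid : ideal_pred J.
  split=> [z|b b' Jb Jb' z|b b' Jb z]; first by rewrite scale0r.
    by rewrite scalerDl; apply: GD.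
  by rewrite -scalerA; apply: GZ.
have [//|nJ1] := lem (J 1).
have [F [phi [phi_surj phi0]]] := max_ideal_field Jid nJ1.
have [V [u qu]] := quotient_module phi_surj T.
have bc0 := quotient_map_base_change phi_surj qu.
have [n [f f_bij]] : exists n (f : {linear V -> 'rV[F]_n}), bijective f.
  apply: (@spanned_row_iso F V p (u \o x)) => y; have [z <-] := qu.1 y.
  have [c ->] := xE z; exists (phi \o c); rewrite linear_sum.
  by apply: eq_bigr => i _; rewrite semilinearZ.
have [f' fK f'K] := f_bij.
have [u1 u1E] : {u1 : {linear T -> 'rV[F]_n | phi \; *:%R} | forall z, u1 z = f (u z)}.
  by apply: semilinear_ex => b z z'; rewrite linearD semilinearZ linearP.
have u1_surj y : exists z, u1 z = y.
  by have [z zE] := qu.1 (f' y); exists z; rewrite u1E zE f'K.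
have u1_ker z : u1 z = 0 -> ideal_multiple phi z.
  move=> z0; apply: qu.2; apply: (can_inj fK).
  by rewrite -u1E z0 linear0.
have bc : is_base_change u1.
  by apply: (quotient_map_base_change phi_surj); split.
have [act actE] : exists act : A -> 'End('rV[F]_n),
    forall a z, act a (u1 z) = u1 (rep_act T a z).
  have /choice[act actE] : forall a, exists g : 'End('rV[F]_n),
      forall z, g (u1 z) = u1 (rep_act T a z).
    move=> a; have [h hE] : {h : {linear T -> 'rV[F]_n | phi \; *:%R} |
        forall z, h z = u1 (rep_act T a z)}.
      by apply: semilinear_ex => b z z'; rewrite !linearD linearZ semilinearZ.
    have [[g gE] _] := bc _ h; exists (linfun g) => z.
    by rewrite lfunE -hE; exact: gE.
  by exists act.
have {}st := st F phi _ u1 act bc actE.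
have [N [gN Ng]] := span_family (fun a => u1 (rep_act T a t)).
have Nsub : submodule act N.
  move=> a; apply/subvP => _ /memv_imgP[y /Ng[w ->] ->].
  rewrite linear_lc /lc rpred_sum // => q _ /=; apply: rpredZ.
  by rewrite actE -rep_actM.
have tN : u1 t \in N by rewrite -[t]rep_act1.
(* The coordinate of the root line base-changes to a functional with value 1 at [u1 t]. *)
have t_neq0 : u1 t != 0.
  have [h [ht _]] := root_coord troot.
  have [h' h'E] := semilinear_dual phi h.
  have [[g gE] _] := bc _ h'; apply/eqP => u0.
  have /eqP := gE t; rewrite /= u0 linear0 h'E ht rmorph1 eq_sym.
  by rewrite (negbTE (oner_neq0 F)).
have N0 : N != 0%VS by apply: contraNneq t_neq0 => N0; rewrite -memv0 -N0.
(* Some [a j] is nonzero in [F] because the [a j] generate the unit ideal; the [v i] elements of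
   that chart then span the fibre at [i]. *)
have dim_le i : (\dim (act (va_idem i) @: N) <= v i)%N.
  have [m [a [b [ab loc]]]] := lf i.
  have [j phia] : exists j, phi (a j) != 0.
    apply/existsP; have : (1 : F) != 0 := oner_neq0 _.
    apply: contraR; rewrite negb_exists => /forallP a0.
    rewrite -(rmorph1 phi) -ab rmorph_sum big1 // => j _.
    by have := a0 j; rewrite negbK rmorphM => /eqP ->; rewrite mulr0.
  have [s [_ sgen _]] := loc j.
  have sub : (act (va_idem i) @: N <= <<[seq u1 (s l) | l <- enum 'I_(v i)]>>)%VS.
    apply/subvP => _ /memv_imgP[y _ ->]; have [z <-] := u1_surj y.
    rewrite actE; have [q [c E]] := sgen _ (rep_vert_proj i z).
    have phiaq : phi (a j ^+ q) != 0 by rewrite rmorphXn expf_neq0.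
    rewrite -[u1 _]scale1r -(mulVf phiaq) -scalerA -semilinearZ E linear_sum.
    apply: rpredZ; apply: rpred_sum => l _; rewrite semilinearZ.
    by apply/rpredZ/memv_span/map_f; rewrite mem_enum.
  apply: leq_trans (dimvS sub) _; apply: leq_trans (dim_span _) _.
  by rewrite size_map size_enum_ord.
have Nfull : N = fullv.
  apply/eqP; apply/negPn/negP => Nfull.
  have := st N Nsub N0 Nfull; apply/negP; rewrite -leNgt -theta_v /theta_dim.
  apply: ler_sum => i _; have [->|io] := eqVneq i (va_root A); last first.
    by rewrite ler_wpM2l ?ler_nat // ltW // theta_gt0.
  (* The weight at the root may be negative, so an inequality of dimensions would not do there. *)
  suff -> : \dim (act (va_idem (va_root A)) @: N) = v (va_root A) by [].
  apply/eqP; rewrite eqn_leq dim_le v_root lt0n dimv_eq0.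
  apply: contraNneq t_neq0 => E; rewrite -memv0 -E -[t]troot.1 -actE.
  exact: memv_img.
(* Nakayama: [T = G + m T] gives [\det (1 - M) T <= G] with [M] over [m]. *)
have lift z : exists (c : 'I_p -> B), (forall i, phi (c i) = 0) /\
    G (z - \sum_i c i *: x i).
  have /Ng[w wE] : u1 z \in N by rewrite Nfull memvf.
  have /choice[s sE] := phi_surj.
  have [w' w'E] : exists w', u1 (lc (orb t) w') = lc (fun a => u1 (rep_act T a t)) w.
    exists [seq (s q.1, q.2) | q <- w]; rewrite semilinear_lc /wmap -map_comp /lc.
    by rewrite big_map; apply: eq_bigr => q _ /=; rewrite sE.
  have /u1_ker[w2 [w20 w2E]] : u1 (z - lc (orb t) w') = 0.
    by rewrite linearB w'E wE subrr.
  have [c [c0 cE]] : exists c : 'I_p -> B, (forall i, phi (c i) = 0) /\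
      lc id w2 = \sum_i c i *: x i.
    elim: w2 w20 {w2E} => [|[b y] w2 IH] /=.
      exists (fun=> 0); split=> [i|]; first exact: rmorph0.
      by rewrite /lc big_nil big1 // => i _; rewrite scale0r.
    case/andP=> /eqP b0 /IH[c [c0 E]]; have [d ->] := xE y.
    exists (fun i => b * d i + c i); split=> [i|].
      by rewrite rmorphD rmorphM b0 c0 mul0r addr0.
    rewrite /lc big_cons -/(lc id w2) E scaler_sumr -big_split.
    by apply: eq_bigr => i _; rewrite scalerDl scalerA.
  exists c; split=> //; rewrite -cE -w2E opprB addrCA subrr addr0.
  by exists w'.
have /choice[c cP] := fun i => lift (x i).
pose M : 'M[B]_p := \matrix_(i, j) c i j.
pose d := \det (1%:M - M).
have phid : phi d = 1.
  rewrite /d -det_map_mx raddfB /= map_scalar_mx rmorph1.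
  suff -> : map_mx phi M = 0 by rewrite subr0 det1.
  by apply/matrixP => i j; rewrite !mxE (cP i).1.
have Gx j : G (d *: x j).
  have -> : d *: x j
      = \sum_i (\adj (1%:M - M)) j i *: (x i - \sum_l c i l *: x l).
    have -> : d *: x j = \sum_l (d%:M : 'M[B]_p) j l *: x l.
      rewrite (bigD1 j) //= mxE eqxx big1 ?addr0 // => l /negbTE lj.
      by rewrite mxE eq_sym lj scale0r.
    rewrite -mul_adj_mx.
    transitivity (\sum_l \sum_i ((\adj (1%:M - M)) j i * (1%:M - M) i l) *: x l).
      by apply: eq_bigr => l _; rewrite mxE scaler_suml.
    rewrite exchange_big; apply: eq_bigr => i _ /=.
    under eq_bigr do rewrite -scalerA.
    rewrite -scaler_sumr; congr (_ *: _).
    have ME l : (1%:M - M) i l = (i == l)%:R - c i l by rewrite !mxE.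
    under [LHS]eq_bigr do rewrite ME scalerBl.
    rewrite sumrB (bigD1 i) //= eqxx scale1r big1 ?addr0 // => l /negbTE li.
    by rewrite eq_sym li scale0r.
  by apply: Gsum => i; apply: GZ; exact: (cP i).2.
have /phi0 /eqP : J d.
  move=> z; have [b ->] := xE z; rewrite scaler_sumr; apply: Gsum => i.
  by rewrite scalerA mulrC -scalerA; apply: GZ.
by rewrite phid (negbTE (oner_neq0 F)).
Qed.

End Generation.

(** * Pulling back and cornering families *)

Section Pullback.
Variables (k : fieldType) (A : vertex_algebra k).

(** The coordinate of [t] base-changes to a functional with value 1 at [u t], so the factor [c] in u
    t = c t' is a unit. *)
Lemma root_pull (B C : comAlgType k) (phi : {lrmorphism B -> C})
    (T : rep A B) (T' : rep A C) (u : {linear T -> T' | phi \; *:%R}) t :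
  is_base_change u -> (forall a x, u (rep_act T a x) = rep_act T' a (u x)) ->
  is_root t -> (exists t' : T', is_root t') -> is_root (u t).
Proof.
move=> bc uact troot [t' [t'0 t'U]].
have [h [ht _]] := root_coord troot.
have ut0 : rep_vert (T := T') (va_root A) (u t) by rewrite /rep_vert -uact troot.1.
have [h' h'E] := semilinear_dual phi h.
have [[g gE] _] := bc _ h'.
have gut : g (u t) = 1 by have /= -> := gE t; rewrite h'E ht rmorph1.
have [c [cE _]] := t'U _ ut0.
have gc : g t' * c = 1 by rewrite -gut cE linearZ mulrC.
split=> // x /t'U[b [bE _]]; exists (b * g t'); split.
  by rewrite cE scalerA -mulrA gc mulr1.
move=> d dE; have : g x = d * g (u t) by rewrite dE linearZ.
by rewrite gut mulr1 => <-; rewrite bE linearZ.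
Qed.

Lemma locally_free_quotient (B D : comNzRingType) (pi : {rmorphism B -> D})
    (T : lmodType B) (T' : lmodType D) (u : {linear T -> T' | pi \; *:%R})
    (e : {linear T -> T}) (S : T -> Prop) (S' : T' -> Prop) r :
  (forall d, exists b, pi b = d) -> quotient_map u ->
  (forall x, S x <-> e x = x) -> (forall x, e (e x) = e x) ->
  (forall y, S' y <-> exists2 x, S x & u x = y) ->
  locally_free S r -> locally_free S' r.
Proof.
move=> pi_surj qu SP ee S'P [m [f [g [fg loc]]]].
exists m, (fun i => pi (f i)), (fun i => pi (g i)); split.
  by rewrite -(rmorph1 pi) -fg rmorph_sum; apply: eq_bigr => i _; rewrite rmorphM.
move=> i; have [t [St tgen tfree]] := loc i; exists (fun j => u (t j)); split.
- by move=> j; apply/S'P; exists (t j).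
- move=> y /S'P[x /tgen[N [c E]] <-]; exists N, (fun j => pi (c j)).
  by rewrite -rmorphXn -semilinearZ E linear_sum; apply: eq_bigr => j _; rewrite semilinearZ.
move=> d d0; have /choice[b bE] := fun j => pi_surj (d j).
(* The lifted relation has its value [z] in (ker pi) T, so up to a power of [f i] it is also a
   combination of the [t j] with coefficients in ker pi. Independence over [B] compares the two, and
   [pi] kills the second. *)
pose z := \sum_j b j *: t j.
have /qu.2[w [w0 wE]] : u z = 0.
  by rewrite -d0 linear_sum; apply: eq_bigr => j _; rewrite semilinearZ bE.
have Sez : e z = z.
  by rewrite linear_sum; apply: eq_bigr => j _; rewrite linearZ /= ((SP _).1 (St j)).
have [N [c [c0 cE]]] : exists N (c : 'I_r -> B),
    (forall j, pi (c j) = 0) /\ f i ^+ N *: e (lc id w) = \sum_j c j *: t j.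
  elim: w w0 {wE} => [|[a y] w IH] /=.
    exists 0%N, (fun=> 0); split=> [j|]; first exact: rmorph0.
    by rewrite /lc big_nil linear0 scaler0 big1 // => j _; rewrite scale0r.
  case/andP=> /eqP a0 /IH[N [c [c0 E]]].
  have [|N' [c' E']] := tgen (e y); first by apply/SP.
  exists (N' + N)%N, (fun j => f i ^+ N * (a * c' j) + f i ^+ N' * c j).
  split=> [j|]; first by rewrite rmorphD !rmorphM a0 c0 mul0r !mulr0 addr0.
  rewrite /lc big_cons -/(lc id w) linearD linearZ /= scalerDr.
  rewrite {1}addnC !exprD -!scalerA E [_ *: (a *: _)]scalerA mulrC -scalerA E'.
  rewrite !scaler_sumr -big_split; apply: eq_bigr => j _.
  by rewrite /= scalerDl !scalerA !mulrA.
have [|N' N'0] := tfree (fun j => f i ^+ N * b j - c j).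
  under eq_bigr do rewrite scalerBl -scalerA.
  by rewrite sumrB -scaler_sumr -cE -wE -/z Sez subrr.
exists (N' + N)%N => j; have := congr1 pi (N'0 j).
rewrite rmorph0 rmorphM rmorphB rmorphM c0 subr0 bE !rmorphXn => <-.
by rewrite exprD mulrA.
Qed.

(** Stability passes to the quotient because generation by the root section does. *)
Lemma pull_quotient (v : va_vert A -> nat) (theta : va_vert A -> rat)
    (B D : comAlgType k) (pi : {lrmorphism B -> D}) (T : rep A B) (t : T) :
  (forall d, exists b, pi b = d) ->
  (forall i, i != va_root A -> 0 < theta i) ->
  (forall i, locally_free (rep_vert (T := T) i) (v i)) ->
  is_root t -> generates (orb t) ->
  exists (T' : rep A D) (u : {linear T -> T' | pi \; *:%R}),
    [/\ quotient_map u, forall a x, u (rep_act T a x) = rep_act T' a (u x)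
      & stable_family v theta T'].
Proof.
move=> pi_surj theta_gt0 lf troot gen.
have [V [u qu]] := quotient_module pi_surj T.
have bc := quotient_map_base_change pi_surj qu.
have usurj := qu.1.
have /choice[act actE] : forall a, exists g : {linear V -> V},
    forall z, g (u z) = u (rep_act T a z).
  move=> a; have [h hE] : {h : {linear T -> V | pi \; *:%R} |
      forall z, h z = u (rep_act T a z)}.
    by apply: semilinear_ex => b z z'; rewrite !linearD linearZ semilinearZ.
  by have [[g gE] _] := bc _ h; exists g => z; rewrite -hE; exact: gE.
have act1 y : act 1 y = y.
  by have [x <-] := usurj y; rewrite actE rep_act1.
have actM a b y : act (a * b) y = act a (act b y).
  by have [x <-] := usurj y; rewrite !actE rep_actM.
have actP (c : k) a b y : act (c *: a + b) y = (c%:A : D) *: act a y + act b y.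
  have [x <-] := usurj y; rewrite !actE rep_actP linearD semilinearZ.
  congr (_ *: _ + _); rewrite -[in RHS](rmorph1 pi); exact: (linearZ_LR pi).
pose T' : rep A D := Rep act1 actM actP.
exists T', u; split=> //.
have uact a x : u (rep_act T a x) = rep_act T' a (u x) by rewrite actE.
have vertP i (y : T') : rep_vert i y <-> exists2 x, rep_vert (T := T) i x & u x = y.
  split=> [yi|[x xi <-]]; last by rewrite /rep_vert -uact xi.
  have [x xE] := usurj y; exists (rep_act T (va_idem i) x).
    exact: rep_vert_proj.
  by rewrite uact xE.
have troot' : is_root (u t : T').
  have [h [ht hE]] := root_coord troot.
  have [h' h'E] := semilinear_dual pi h.
  have [[g gE] _] := bc _ h'.
  have gut : g (u t) = 1 by have /= -> := gE t; rewrite h'E ht rmorph1.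
  split; first by apply/vertP; exists t => //; exact: troot.1.
  move=> y /vertP[x x0 <-]; exists (pi (h x)); split.
    by rewrite -[x in LHS]x0 hE semilinearZ.
  move=> d dE; rewrite -h'E; have /= <- := gE x.
  by rewrite dE linearZ /= gut [_ *: _]mulr1.
split.
- move=> i; have ee x : rep_act T (va_idem i) (rep_act T (va_idem i) x)
      = rep_act T (va_idem i) x by rewrite rep_vert_orth eqxx.
  exact: (locally_free_quotient pi_surj qu (rep_vertE (T := T) i) ee (vertP i) (lf i)).
- by exists (u t) => //; [exact: troot'.1 | exact: troot'.2].
apply: (stable_of_generated theta_gt0 troot').
have gen' : generates (u \o orb t).
  apply: generates_comp gen _ => y; have [x <-] := usurj y.
  by exists [:: (1, x)]; rewrite lc1.
move=> y; have [w ->] := gen' y; exists w; apply: eq_lc => a /=.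
exact: uact.
Qed.

End Pullback.

Section Submodule.
Variables (B : comNzRingType) (T : lmodType B) (S : T -> Prop).
Hypotheses (S0 : S 0) (SD : forall b x y, S x -> S y -> S (b *: x + y)).

(* The closure hypotheses are arguments so that the instance below applies. *)
Definition submod_pred of S 0 & (forall b x y, S x -> S y -> S (b *: x + y)) :
  pred T := fun x => `[< S x >].

Fact submod_pred_closed : submod_closed (submod_pred S0 SD).
Proof.
split=> [|b x y /asboolP Sx /asboolP Sy]; apply/asboolP => //; exact: SD.
Qed.
HB.instance Definition _ :=
  GRing.isSubmodClosed.Build B T (submod_pred S0 SD) submod_pred_closed.

Definition submod_sub := {x : T | submod_pred S0 SD x}.
HB.instance Definition _ := SubChoice.on submod_sub.
HB.instance Definition _ := [SubChoice_isSubZmodule of submod_sub by <:].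
HB.instance Definition _ := [SubZmodule_isSubLmodule of submod_sub by <:].

Lemma submodule_ex : exists (N : lmodType B) (w : {linear N -> T}),
  injective w /\ forall x, (exists y, w y = x) <-> S x.
Proof.
exists submod_sub, (val : submod_sub -> T); split; first exact: val_inj.
move=> x; split=> [[y <-]|Sx]; first exact/asboolP/(valP y).
have Kx : submod_pred S0 SD x by apply/asboolP.
by exists (exist _ x Kx).
Qed.

End Submodule.

(** * The corner [e_I T] as a retract of [T] *)

Section Corner.
Variables (k : fieldType) (A : vertex_algebra k).
Variables (I : {set va_vert A}) (I0 : va_root A \in I).
Local Notation AI := (corner_algebra I0).
Local Notation eI := (idem_sum I).

Lemma to_corner_subproof (a : A) : in_corner (cornering_idem I0) (eI * a * eI).
Proof.
rewrite /in_corner /=; apply/eqP.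
by rewrite !mulrA idem_sum_idem -!mulrA idem_sum_idem.
Qed.

(** Compression to the corner is linear but in general not multiplicative; what matters is its
    action on root sections, which [eI] fixes. *)
Definition to_corner (a : A) : AI := exist _ (eI * a * eI) (to_corner_subproof a).

Lemma val_corner_l (b : AI) : eI * val b = val b.
Proof. exact: (corner_l (b : corner (cornering_idem I0))). Qed.

Lemma val_corner_r (b : AI) : val b * eI = val b.
Proof. exact: (corner_r (b : corner (cornering_idem I0))). Qed.

(** The relation [cornering] without the stability of the two families, so that it applies to
    families under construction. *)
Definition cornered (B : comAlgType k) (T : rep A B) (N : rep AI B) : Prop :=
  exists w : {linear N -> T},
    [/\ injective w, forall x, (exists y, w y = x) <-> rep_act T eI x = x
      & forall a y, w (rep_act N a y) = rep_act T (val a) (w y)].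

Lemma cornered_intro (B : comAlgType k) (T : rep A B) (N : rep AI B)
    (w : {linear N -> T}) (r : {linear T -> N}) :
  (forall y, r (w y) = y) -> (forall x, w (r x) = rep_act T eI x) ->
  (forall a y, w (rep_act N a y) = rep_act T (val a) (w y)) -> cornered T N.
Proof.
move=> rw wr wact; exists w; split=> // [|x]; first exact: can_inj rw.
split=> [[y <-]|<-]; last by exists (r x).
by rewrite -wr rw.
Qed.

Section Retraction.
Variables (B : comAlgType k) (T : rep A B) (N : rep AI B).

(** e_I T is a direct summand of [T]: [r] is multiplication by e_I followed by the inverse of [w] on
    its image. *)
Lemma cornered_retract : cornered T N ->
  exists (w : {linear N -> T}) (r : {linear T -> N}),
    [/\ forall y, r (w y) = y, forall x, w (r x) = rep_act T eI x
      & forall a y, w (rep_act N a y) = rep_act T (val a) (w y)].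
Proof.
move=> [w [w_inj w_im w_act]].
have /choice[s sE] : forall x, exists y, w y = rep_act T eI x.
  by move=> x; apply/w_im; rewrite -rep_actM idem_sum_idem.
have [|r rE] := @linear_ex B T N s.
  by move=> b x y; apply: w_inj; rewrite linearP !sE linearP.
exists w, r; split=> // [y|x]; rewrite rE //.
by apply: w_inj; rewrite sE; apply/w_im; exists y.
Qed.

Variables (w : {linear N -> T}) (r : {linear T -> N}).
Hypotheses (rw : forall y, r (w y) = y) (wr : forall x, w (r x) = rep_act T eI x).
Hypothesis wact : forall a y, w (rep_act N a y) = rep_act T (val a) (w y).

Lemma retract_inj : injective w.
Proof. exact: can_inj rw. Qed.

Lemma retract_corner y : rep_act T eI (w y) = w y.
Proof. by rewrite -wr rw. Qed.

Lemma retract_act (b : AI) x : r (rep_act T (val b) x) = rep_act N b (r x).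
Proof.
apply: retract_inj; rewrite wact !wr -!rep_actM.
by rewrite val_corner_l val_corner_r.
Qed.

Lemma retract_vert (i : va_vert AI) y :
  rep_vert (T := N) i y <-> rep_vert (T := T) (val i) (w y).
Proof.
rewrite /rep_vert -[va_idem (val i)]/(val (va_idem i : AI)) -wact.
by split=> [->|/retract_inj].
Qed.

Lemma vert_corner i x : i \in I -> rep_vert (T := T) i x -> rep_act T eI x = x.
Proof. by move=> iI xi; rewrite -[x in LHS]xi -rep_actM idem_sum_l iI. Qed.

Lemma root_retract t : is_root t -> w (r t) = t.
Proof. by move=> [t0 _]; rewrite wr (vert_corner I0 t0). Qed.

Lemma is_root_retract t : is_root t -> is_root (r t).
Proof.
move=> troot; have [t0 tU] := troot; split.
  by apply/retract_vert; rewrite root_retract.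
move=> x /retract_vert /tU[b [bE bU]]; exists b; split.
  by apply: retract_inj; rewrite linearZ /= root_retract.
by move=> c cE; apply: bU; rewrite cE linearZ /= root_retract.
Qed.

Lemma is_root_section n : is_root n -> is_root (w n).
Proof.
move=> [n0 nU]; split; first by move/retract_vert: n0.
move=> x x0; have xE : w (r x) = x by rewrite wr (vert_corner I0 x0).
have /nU[b [bE bU]] : rep_vert (T := N) (va_root AI) (r x).
  by apply/retract_vert; rewrite xE.
exists b; split; first by rewrite -xE bE linearZ.
by move=> c cE; apply: bU; rewrite cE linearZ /= rw.
Qed.

Lemma retract_to_corner t a : rep_act T eI t = t ->
  w (rep_act N (to_corner a) (r t)) = rep_act T (eI * a) t.
Proof. by move=> tI; rewrite wact wr tI /= rep_actM tI. Qed.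

Lemma corner_generates t : rep_act T eI t = t ->
  generates (orb t) -> generates (fun a => rep_act N (to_corner a) (r t)).
Proof.
move=> tI gen y; have [ww E] := gen (w y); exists ww.
apply: retract_inj; rewrite -retract_corner E lc_orb_act linear_lc.
by apply: eq_lc => a; rewrite /= retract_to_corner.
Qed.

Lemma corner_locally_free (i : va_vert AI) m :
  locally_free (rep_vert (T := T) (val i)) m -> locally_free (rep_vert (T := N) i) m.
Proof.
have wri x : rep_vert (T := T) (val i) x -> w (r x) = x.
  by move=> xi; rewrite wr (vert_corner (valP i) xi).
move=> [p [f [g [fg loc]]]]; exists p, f, g; split=> // j.
have [t [ti tgen tfree]] := loc j; exists (fun l => r (t l)); split=> [l|y|c c0].
- by apply/retract_vert; rewrite wri.
- move=> /retract_vert /tgen[q [c E]]; exists q, c.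
  rewrite -[y]rw -linearZ E linear_sum; apply: eq_bigr => l _; exact: linearZ.
- apply: tfree; have := congr1 w c0; rewrite linear0 linear_sum => E; rewrite -[RHS]E.
  by apply: eq_bigr => l _; rewrite linearZ /= wri.
Qed.

Lemma corner_locally_free_section (i : va_vert AI) m :
  locally_free (rep_vert (T := N) i) m -> locally_free (rep_vert (T := T) (val i)) m.
Proof.
have wri x : rep_vert (T := T) (val i) x -> w (r x) = x.
  by move=> xi; rewrite wr (vert_corner (valP i) xi).
move=> [p [f [g [fg loc]]]]; exists p, f, g; split=> // j.
have [t [ti tgen tfree]] := loc j; exists (fun l => w (t l)); split=> [l|y yi|c c0].
- by apply/retract_vert.
- have [|q [c E]] := tgen (r y); first by apply/retract_vert; rewrite wri.
  exists q, c; rewrite -[y]wri // -linearZ E linear_sum.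
  by apply: eq_bigr => l _; rewrite /= linearZ.
- apply: tfree; apply: retract_inj; rewrite linear0 linear_sum -[RHS]c0.
  by apply: eq_bigr => l _; rewrite linearZ.
Qed.

End Retraction.

(** e_I a t = (e_I a e_I) t because e_I fixes [t]; hence [t] generates e_I T over the corner
    algebra, and stability follows. *)
Lemma corner_family (v : va_vert A -> nat) (thetaI : va_vert AI -> rat)
    (B : comAlgType k) (T : rep A B) (t : T) :
  (forall i, i != va_root AI -> 0 < thetaI i) ->
  (forall i, locally_free (rep_vert (T := T) i) (v i)) ->
  is_root t -> generates (orb t) ->
  exists2 N : rep AI B, stable_family (corner_vector v I0) thetaI N & cornered T N.
Proof.
move=> theta_gt0 lf troot gen.
have [||V [w [w_inj w_im]]] := @submodule_ex B T (fun x => rep_act T eI x = x).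
- exact: linear0.
- by move=> b x y xE yE; rewrite linearP /= xE yE.
have wI y : rep_act T eI (w y) = w y by apply/w_im; exists y.
have /choice[act actE] : forall a : AI, exists f : {linear V -> V},
    forall y, w (f y) = rep_act T (val a) (w y).
  move=> a; have /choice[f fE] : forall y, exists z, w z = rep_act T (val a) (w y).
    by move=> y; apply/w_im; rewrite -rep_actM val_corner_l.
  have [|f' f'E] := @linear_ex B V V f.
    by move=> b x y; apply: w_inj; rewrite linearP !fE !linearP.
  by exists f' => y; rewrite f'E fE.
have act1 y : act 1 y = y by apply: w_inj; rewrite actE wI.
have actM a b y : act (a * b) y = act a (act b y).
  by apply: w_inj; rewrite !actE -rep_actM.
have actP (c : k) a b y : act (c *: a + b) y = (c%:A : B) *: act a y + act b y.
  by apply: w_inj; rewrite linearP !actE -rep_actP.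
pose N : rep AI B := Rep act1 actM actP.
have cTN : cornered T N by exists w; split.
exists N => //; have {actE wI w_im w_inj w cTN} [w [r [rw wr wact]]] := cornered_retract cTN.
have nroot := is_root_retract rw wr wact troot.
split.
- by move=> i; apply: (corner_locally_free rw wr wact); exact: lf.
- by exists (r t); [exact: nroot.1 | exact: nroot.2].
apply: (stable_of_generated theta_gt0 nroot) => y.
have tI := vert_corner I0 troot.1.
have [ww ->] := corner_generates rw wr wact tI gen y.
exists [seq (p.1, to_corner p.2) | p <- ww].
by rewrite /lc big_map.
Qed.

(** As e_I T is a direct summand, its base change is cut out of that of [T]: existence and
    uniqueness of maps pass through the retractions. *)
Lemma cornered_pull (B C : comAlgType k) (phi : {lrmorphism B -> C})
    (T : rep A B) (T' : rep A C) (N : rep AI B) (N' : rep AI C) :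
  rep_pull phi T T' -> cornered T N -> cornered T' N' -> rep_pull phi N N'.
Proof.
move=> [u bc uact] /cornered_retract[w [r [rw wr wact]]].
move=> /cornered_retract[w' [r' [r'w' w'r' w'act]]].
have [uN uNE] := semilinear_comp w u r'.
have w'uN y : w' (uN y) = u (w y).
  by rewrite uNE w'r' -uact (retract_corner rw wr).
exists uN; last first.
  move=> a y; apply: (retract_inj r'w').
  by rewrite w'act !w'uN wact uact.
move=> P h; split.
  have [h' h'E] : {h' : {linear T -> P | phi \; *:%R} | forall x, h' x = h (r x)}.
    by apply: semilinear_ex => b x y; rewrite !linearD linearZ semilinearZ.
  have [[g gE] _] := bc P h'.
  have [|g' g'E] := @linear_ex C N' P (fun y => g (w' y)).
    by move=> b x y; rewrite !linearP.
  exists g' => y /=; rewrite g'E w'uN; have /= -> := gE (w y).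
  by rewrite h'E rw.
move=> g1 g2 g12 y; rewrite -[y]r'w'.
have comp (g : {linear N' -> P}) : {f : {linear T' -> P} | forall x, f x = g (r' x)}.
  by apply: linear_ex => b x z; rewrite !linearP.
have [f1 f1E] := comp g1; have [f2 f2E] := comp g2.
rewrite -f1E -f2E; apply: (base_change_ext bc) => x; rewrite f1E f2E.
have -> : r' (u x) = uN (r x); last exact: g12.
by apply: (retract_inj r'w'); rewrite w'uN wr w'r' uact.
Qed.

Lemma pull_id_inverse (A' : vertex_algebra k) (B : comAlgType k) (N N' : rep A' B) :
  rep_pull idfun N N' ->
  exists (u : {linear N -> N'}) (g : {linear N' -> N}),
    [/\ cancel u g, cancel g u
      & forall a y, g (rep_act N' a y) = rep_act N a (g y)].
Proof.
move=> [u' bc uact]; have [u uE] := linear_of_id u'.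
have [i iE] : {i : {linear N -> N | idfun \; *:%R} | forall x, i x = x}.
  by apply: (semilinear_ex (phi := idfun)) => b x y.
have [[g gE] _] := bc N i.
have gu : cancel u g by move=> x; rewrite uE -[RHS]iE; exact: gE.
have comp : {f : {linear N' -> N'} | forall y, f y = u (g y)}.
  by apply: linear_ex => b x y; rewrite !linearP.
have [f fE] := comp.
have [j jE] : {j : {linear N' -> N'} | forall y, j y = y} by apply: linear_ex.
have ug : cancel g u.
  move=> y; rewrite -fE -[RHS]jE; apply: (base_change_ext bc) => x.
  by rewrite fE jE -uE gu.
exists u, g; split=> // a y; rewrite -{1}[y]ug.
by rewrite uE -uact -uE gu.
Qed.

Lemma cornered_same (B : comAlgType k) (T : rep A B) (N N' : rep AI B) :
  cornered T N -> rep_pull idfun N N' -> cornered T N'.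
Proof.
move=> /cornered_retract[w [r [rw wr wact]]] /pull_id_inverse[u [g [gu ug gact]]].
have [w' w'E] : {w' : {linear N' -> T} | forall y, w' y = w (g y)}.
  by apply: linear_ex => b x y; rewrite !linearP.
have [r' r'E] : {r' : {linear T -> N'} | forall y, r' y = u (r y)}.
  by apply: linear_ex => b x y; rewrite !linearP.
apply: (@cornered_intro _ _ _ w' r') => [y|x|a y]; rewrite ?w'E ?r'E.
- by rewrite rw ug.
- by rewrite gu wr.
- by rewrite gact wact.
Qed.

End Corner.

(** * Recovering a family from its corners *)

Section CoverPull.
Variables (k : fieldType) (A : vertex_algebra k) (l : nat).
Variables (I : 'I_l -> {set va_vert A}) (I0 : forall j, va_root A \in I j).
Hypothesis cover : forall i, exists j, i \in I j.
Local Notation AI j := (corner_algebra (I0 j)).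

Section OneCorner.
Variables (B C : comAlgType k) (phi : {lrmorphism B -> C}) (j : 'I_l).
Variables (T : rep A B) (T' : rep A C) (N : rep (AI j) B) (N' : rep (AI j) C).

(* [U] is the pull-back map of the corner, transported to [e_I T -> e_I T'] and
   extended by [0]; [c] compares the two trivialisations of the root line. *)
Lemma corner_transport (t : T) (t' : T') :
  is_root t -> is_root t' -> cornered T N -> cornered T' N' -> rep_pull phi N N' ->
  exists (U : {linear T -> T' | phi \; *:%R}) (c d : C),
    [/\ forall i x, i \in I j ->
          U (rep_act T (va_idem i) x) = rep_act T' (va_idem i) (U x),
        forall i a, i \in I j -> rep_act T' (va_idem i) (U (rep_act T a t))
          = rep_act T' (va_idem i) (c *: rep_act T' a t'),
        c * d = 1,
        forall (P : lmodType C) (h : {linear T -> P | phi \; *:%R}),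
          exists g : {linear T' -> P}, forall i x, i \in I j ->
            g (rep_act T' (va_idem i) (U x)) = h (rep_act T (va_idem i) x)
      & forall (P : lmodType C) (g g' : {linear T' -> P}),
          (forall x, g (U x) = g' (U x)) ->
          forall i x, i \in I j ->
            g (rep_act T' (va_idem i) x) = g' (rep_act T' (va_idem i) x)].
Proof.
move=> troot troot' cTN cTN' [u bc uact].
have [w [r [rw wr wact]]] := cornered_retract cTN.
have [w' [r' [r'w' w'r' w'act]]] := cornered_retract cTN'.
have nroot := is_root_retract rw wr wact troot.
have nroot' := is_root_retract r'w' w'r' w'act troot'.
have unroot : is_root (u (r t)).
  by apply: root_pull bc uact nroot _; exists (r' t').
have Uroot := is_root_section r'w' w'r' w'act unroot.
have [U UE] : {U : {linear T -> T' | phi \; *:%R} | forall x, U x = w' (u (r x))}.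
  by apply: semilinear_ex => b x y; rewrite !linearD linearZ semilinearZ linearZ.
have UI x : rep_act T' (idem_sum (I j)) (U x) = U x.
  by rewrite UE (retract_corner r'w' w'r').
have Uact (b : AI j) x : U (rep_act T (val b) x) = rep_act T' (val b) (U x).
  by rewrite !UE (retract_act rw wr wact) uact w'act.
have Uvert i x : i \in I j ->
    U (rep_act T (va_idem i) x) = rep_act T' (va_idem i) (U x).
  by move=> iI; exact: (Uact (va_idem (Sub i iI : va_vert (AI j)))).
rewrite -UE in Uroot.
have [t0 tU] := troot'; have [U0 UU] := Uroot.
have [c [cE cU]] := tU _ U0; have [d [dE dU]] := UU _ t0.
exists U, c, d; split=> //.
- move=> i a iI; rewrite -Uvert // -rep_actM.
  (* On the root section [e_i a] acts as the element e_i (e_I a e_I) of the corner algebra, with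
     which [U] commutes. *)
  have -> : U (rep_act T (va_idem i * a) t)
          = U (rep_act T (val (va_idem (Sub i iI : va_vert (AI j)) * to_corner (I0 j) a)) t).
    congr (U _); rewrite /= !mulrA idem_sum_r iI [RHS]rep_actM.
    by rewrite (vert_corner (I0 j) troot.1).
  rewrite Uact /= !mulrA idem_sum_r iI rep_actM UI cE rep_actM !linearZ //=.
- have : exists! b : C, t' = b *: t' by apply: tU.
  case=> b [_ bU]; rewrite -(bU 1) ?scale1r //; symmetry; apply: bU.
  by rewrite mulrC -scalerA -cE.
- move=> P h.
  have [h' h'E] : {h' : {linear N -> P | phi \; *:%R} | forall y, h' y = h (w y)}.
    by apply: semilinear_ex => b x y; rewrite !linearD linearZ semilinearZ.
  have [[g gE] _] := bc P h'.
  have [g' g'E] : {g' : {linear T' -> P} | forall x, g' x = g (r' x)}.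
    by apply: linear_ex => b x y; rewrite !linearP.
  exists g' => i x iI; rewrite g'E -Uvert // UE r'w'.
  have /= -> := gE (r (rep_act T (va_idem i) x)).
  by rewrite h'E wr (vert_corner iI) //; exact: rep_vert_proj.
- move=> P g g' E i x iI.
  have xE : rep_act T' (va_idem i) x = w' (r' (rep_act T' (va_idem i) x)).
    by rewrite w'r' (vert_corner iI) //; exact: rep_vert_proj.
  have comp (f : {linear T' -> P}) : {f' : {linear N' -> P} | forall y, f' y = f (w' y)}.
    by apply: linear_ex => b y z; rewrite !linearP.
  have [f fE] := comp g; have [f' f'E] := comp g'.
  rewrite xE -fE -f'E; apply: (base_change_ext bc) => y.
  by rewrite fE f'E -[y]rw -UE.
Qed.

End OneCorner.

(** On its own vertices the transported map [U j] sends a t to c_j a t'. Dividing by the unit c_j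
    and assembling over a choice [s] of a corner for each vertex gives [v] with v (a t) = a t'.
    Commutation with all of [A], which no single corner shows, follows as [t] generates [T]; the
    universal property is checked vertex by vertex. *)
Lemma cover_pull (B C : comAlgType k) (phi : {lrmorphism B -> C})
    (T : rep A B) (T' : rep A C) (t : T) (t' : T')
    (N : forall j, rep (AI j) B) (N' : forall j, rep (AI j) C) :
  is_root t -> is_root t' -> generates (orb t) ->
  (forall j, cornered T (N j)) -> (forall j, cornered T' (N' j)) ->
  (forall j, rep_pull phi (N j) (N' j)) -> rep_pull phi T T'.
Proof.
move=> troot troot' gen cTN cTN' NN'.
have /choice[U /choice[c /choice[d UP]]] := fun j =>
  corner_transport troot troot' (cTN j) (cTN' j) (NN' j).
have /choice[s sI] := cover.
pose e i := rep_act T (va_idem i); pose e' i := rep_act T' (va_idem i).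
have [v vE] : {v : {linear T -> T' | phi \; *:%R} |
    forall x, v x = \sum_i d (s i) *: e' i (U (s i) x)}.
  apply: semilinear_ex => b x y; rewrite scaler_sumr -big_split.
  apply: eq_bigr => i _ /=; rewrite !linearD semilinearZ !linearZ /=.
  by rewrite ?scalerDr !scalerA mulrC.
have e'v i x : e' i (v x) = d (s i) *: e' i (U (s i) x).
  rewrite vE linear_sum (bigD1 i) //= linearZ /= rep_vert_orth eqxx.
  rewrite big1 ?addr0 // => i' /negbTE ii'.
  by rewrite linearZ /= rep_vert_orth eq_sym ii' scaler0.
have vt a : v (rep_act T a t) = rep_act T' a t'.
  rewrite vE [RHS]rep_vert_sum; apply: eq_bigr => i _.
  have [_ UtE cd _ _] := UP (s i).
  by rewrite UtE ?sI // linearZ /= scalerA mulrC cd scale1r.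
have vact a x : v (rep_act T a x) = rep_act T' a (v x).
  have [f fE] : {f : {linear T -> T' | phi \; *:%R} | forall x, f x = v (rep_act T a x)}.
    by apply: semilinear_ex => b y z; rewrite !linearD linearZ semilinearZ.
  have [f' f'E] : {f : {linear T -> T' | phi \; *:%R} | forall x, f x = rep_act T' a (v x)}.
    by apply: semilinear_ex => b y z; rewrite !linearD semilinearZ linearZ.
  rewrite -fE -f'E; apply: (semilinear_eq gen) => b.
  by rewrite fE f'E /orb -rep_actM !vt rep_actM.
exists v => // P h; split.
  have /choice[g gE] : forall j, exists g : {linear T' -> P}, forall i x, i \in I j ->
      g (e' i (U j x)) = h (e i x).
    by move=> j; have [_ _ _ + _] := UP j; apply.
  have [f fE] : {f : {linear T' -> P} |
      forall x, f x = \sum_i c (s i) *: g (s i) (e' i x)}.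
    apply: linear_ex => b x y; rewrite scaler_sumr -big_split.
    apply: eq_bigr => i _ /=; rewrite linearP [g _ _]linearP scalerDr !scalerA.
    by rewrite mulrC.
  exists f => x /=; rewrite fE [in RHS](rep_vert_sum x) linear_sum.
  apply: eq_bigr => i _; have [_ _ cd _ _] := UP (s i).
  by rewrite e'v linearZ scalerA cd scale1r gE ?sI.
move=> g g' E x; rewrite (rep_vert_sum x) !linear_sum; apply: eq_bigr => i _.
have [Uv _ cd _ ext] := UP (s i).
have [f fE] : {f : {linear T' -> P} | forall x, f x = g (e' i x)}.
  by apply: linear_ex => b y z; rewrite !linearP.
have [f' f'E] : {f : {linear T' -> P} | forall x, f x = g' (e' i x)}.
  by apply: linear_ex => b y z; rewrite !linearP.
have e'e' y : e' i (e' i y) = e' i y by rewrite /e' rep_vert_orth eqxx.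
rewrite -/(e' i x) -[e' i x]e'e' -fE -f'E; apply: ext (sI i) => y.
rewrite fE f'E -[e' i _]scale1r -cd -scalerA -e'v -vact.
by rewrite !linearZ; congr (_ *: _); exact: E.
Qed.

End CoverPull.

(** * Gluing families over the corners *)

Section LinearLift.
Variables (B : comNzRingType) (X : Type) (T P : lmodType B) (g : X -> T).
Hypothesis gg : generates g.

Lemma linear_lift (f : X -> P) : (forall w, lc g w = 0 -> lc f w = 0) ->
  {h : {linear T -> P} | forall x, h (g x) = f x}.
Proof.
move=> gf; have [|h hE] := @semilinear_lift B B idfun X T P g f gg.
  move=> w /gf; suff -> : wmap idfun w = w by [].
  by rewrite -[RHS]map_id; apply: eq_map => -[].
by have [h' h'E] := linear_of_id h; exists h' => x; rewrite h'E.
Qed.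

Lemma linear_eq (h h' : {linear T -> P}) :
  (forall x, h (g x) = h' (g x)) -> h =1 h'.
Proof.
by move=> E x; have [w ->] := gg x; rewrite !linear_lc; apply: eq_lc.
Qed.

End LinearLift.

Section Product.
Variables (R : comNzRingType) (J : Type) (N : J -> lmodType R).

(** The ambient module in which the glued family is spanned by tuples of corner elements. *)
Definition dprod : Type := forall j, N j.
Implicit Types p q r : dprod.

HB.instance Definition _ := gen_eqMixin dprod.
HB.instance Definition _ := gen_choiceMixin dprod.

Definition dprod_add p q : dprod := fun j => p j + q j.
Definition dprod_opp p : dprod := fun j => - p j.
Definition dprod_scale (c : R) p : dprod := fun j => c *: p j.

Fact dprod_addA : associative dprod_add.
Proof. by move=> p q r; apply: functional_extensionality_dep => j; exact: addrA. Qed.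
Fact dprod_addC : commutative dprod_add.
Proof. by move=> p q; apply: functional_extensionality_dep => j; exact: addrC. Qed.
Fact dprod_add0 : left_id (fun j => 0) dprod_add.
Proof. by move=> p; apply: functional_extensionality_dep => j; exact: add0r. Qed.
Fact dprod_addN : left_inverse (fun j => 0) dprod_opp dprod_add.
Proof. by move=> p; apply: functional_extensionality_dep => j; exact: addNr. Qed.
HB.instance Definition _ :=
  GRing.isZmodule.Build dprod dprod_addA dprod_addC dprod_add0 dprod_addN.

Fact dprod_scaleA a b p : dprod_scale a (dprod_scale b p) = dprod_scale (a * b) p.
Proof. by apply: functional_extensionality_dep => j; exact: scalerA. Qed.
Fact dprod_scale1 : left_id 1 dprod_scale.
Proof. by move=> p; apply: functional_extensionality_dep => j; exact: scale1r. Qed.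
Fact dprod_scaleDr : right_distributive dprod_scale +%R.
Proof. by move=> c p q; apply: functional_extensionality_dep => j; exact: scalerDr. Qed.
Fact dprod_scaleDl p : {morph dprod_scale^~ p : a b / a + b}.
Proof. by move=> a b; apply: functional_extensionality_dep => j; exact: scalerDl. Qed.
HB.instance Definition _ := GRing.Zmodule_isLmodule.Build R dprod
  dprod_scaleA dprod_scale1 dprod_scaleDr dprod_scaleDl.

Lemma dprodP p q : (forall j, p j = q j) -> p = q.
Proof. exact: functional_extensionality_dep. Qed.

End Product.

Section Glue.
Variables (k : fieldType) (A : vertex_algebra k) (l : nat).
Variables (I : 'I_l -> {set va_vert A}) (I0 : forall j, va_root A \in I j).
Hypothesis cover : forall i, exists j, i \in I j.
Local Notation AI j := (corner_algebra (I0 j)).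
Local Notation e := (@va_idem k A).

(** The presentation of [N] by its root section, extended from the corner algebra to all of [A], so
    that the same combinations of elements of [A] can be tested in every corner. *)
Definition corner_orb (C : comAlgType k) j (N : rep (AI j) C) (n : N) (a : A) : N :=
  rep_act N (to_corner (I0 j) a) n.

Section CornerOrb.
Variables (C : comAlgType k) (j : 'I_l) (N : rep (AI j) C) (n : N).
Local Notation g := (corner_orb n).

Lemma corner_orb_act (b : AI j) x : rep_act N b (g x) = g (val b * x).
Proof.
rewrite /corner_orb -rep_actM; congr (rep_act N _ n); apply: val_inj => /=.
by rewrite !mulrA val_corner_l val_corner_r.
Qed.

Lemma corner_orb_idem x : g (idem_sum (I j) * x) = g x.
Proof.
congr (rep_act N _ n); apply: val_inj => /=.
by rewrite !mulrA idem_sum_idem.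
Qed.

Lemma corner_orbP (c : k) x y : g (c *: x + y) = (c%:A : C) *: g x + g y.
Proof.
rewrite -rep_actP; congr (rep_act N _ n); apply: val_inj => /=.
by rewrite mulrDr mulrDl -scalerAr -scalerAl.
Qed.

Lemma corner_orbD x y : g (x + y) = g x + g y.
Proof. by have := corner_orbP 1 x y; rewrite !scale1r. Qed.

Lemma corner_orb0 : g 0 = 0.
Proof. by apply: (addrI (g 0)); rewrite -corner_orbD !addr0. Qed.

Lemma corner_orb_sum (J : Type) (r : seq J) (Q : pred J) (F : J -> A) :
  g (\sum_(i <- r | Q i) F i) = \sum_(i <- r | Q i) g (F i).
Proof.
by elim/big_rec2: _ => [|i y a _ <-]; rewrite ?corner_orb0 ?corner_orbD.
Qed.

Lemma corner_orb_root x : is_root n -> g (x * e (va_root A)) = g x.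
Proof.
move=> [n0 _]; rewrite /corner_orb -{2}n0 -rep_actM.
congr (rep_act N _ n); apply: val_inj => /=.
by rewrite -!mulrA idem_sum_l idem_sum_r (I0 j).
Qed.

Lemma corner_orb1 : g 1 = n.
Proof.
rewrite /corner_orb -[RHS](rep_act1 (r := N)); congr (rep_act N _ n).
by apply: val_inj; rewrite /= mulr1 idem_sum_idem.
Qed.

Lemma corner_orb_vert i w : i \in I j ->
  lc g w = 0 -> lc (fun x => g (e i * x)) w = 0.
Proof.
move=> iI w0; pose b : AI j := va_idem (Sub i iI : va_vert (AI j)).
have <- : rep_act N b (lc g w) = 0 by rewrite w0 linear0.
by rewrite linear_lc; apply: eq_lc => x /=; rewrite corner_orb_act.
Qed.

Lemma corner_orb_section (T : rep A C) (w : {linear N -> T}) x :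
  rep_act T (idem_sum (I j)) (w n) = w n ->
  (forall a y, w (rep_act N a y) = rep_act T (val a) (w y)) ->
  w (g x) = rep_act T (idem_sum (I j) * x) (w n).
Proof. by move=> nI wact; rewrite wact /= rep_actM nI. Qed.

Lemma generates_corner_orb : generates (orb n) -> generates g.
Proof.
move=> gen y; have [w ->] := gen y; exists [seq (p.1, val p.2) | p <- w].
rewrite [RHS]big_map; apply: eq_bigr => p _; congr (_ *: rep_act N _ n).
by apply: val_inj; rewrite /= val_corner_l val_corner_r.
Qed.

End CornerOrb.

Lemma corner_orb_pull (B C : comAlgType k) (phi : {lrmorphism B -> C}) j
    (N : rep (AI j) B) (N' : rep (AI j) C) (u : {linear N -> N' | phi \; *:%R})
    (n : N) w (f : A -> A) :
  (forall a x, u (rep_act N a x) = rep_act N' a (u x)) ->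
  u (lc (fun x => corner_orb n (f x)) w)
  = lc (fun x => corner_orb (u n) (f x)) (wmap phi w).
Proof. by move=> uact; rewrite semilinear_lc; apply: eq_lc => x /=; rewrite uact. Qed.

Variables (C : comAlgType k) (N : forall j, rep (AI j) C) (n : forall j, N j).

(* The kernels of the presentations by [n] agree on common vertices (take
   [a = 1]), and together form an A-submodule of [A e_0]. *)
Definition compatible : Prop :=
  forall j j' i (a : A) w, i \in I j ->
    lc (fun x => corner_orb (n j) (e i * x)) w = 0 ->
    lc (fun x => corner_orb (n j') (a * (e i * x))) w = 0.

Hypotheses (nroot : forall j, is_root (n j)).
Hypothesis ngen : forall j, generates (corner_orb (n j)).
Hypothesis comp : compatible.

(** [T] is spanned in the product by the tuples [tau x], so a combination is a relation in [T]
    exactly when it is one in every [N j]. Compatibility makes left multiplication by [A], and the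
    maps from the [N j] to [T], well defined on relations. *)
Lemma glue (v : va_vert A -> nat) (theta : va_vert A -> rat) :
  (forall i, i != va_root A -> 0 < theta i) ->
  (forall j i, locally_free (rep_vert (T := N j) i) (v (val i))) ->
  exists2 T : rep A C, stable_family v theta T & forall j, cornered T (N j).
Proof.
move=> theta_gt0 lf.
pose tau (x : A) : dprod N := fun j => corner_orb (n j) x.
have [||T [em [em_inj em_im]]] :=
    @submodule_ex C (dprod N) (fun p => exists w, p = lc tau w).
- by exists [::]; rewrite /lc big_nil.
- move=> b p q [w ->] [w' ->]; exists (wscale b w ++ w').
  by rewrite lc_cat lc_scale.
have /choice[g gE] : forall x, exists y, em y = tau x.
  by move=> x; apply/em_im; exists [:: (1, x)]; rewrite lc1.
have gen : generates g.
  move=> y; have [w wE] : exists w, em y = lc tau w by apply/em_im; exists y.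
  by exists w; apply: em_inj; rewrite wE linear_lc; apply: eq_lc => x; rewrite /= gE.
have prP j : {pr : {linear T -> N j} | forall y, pr y = em y j}.
  by apply: linear_ex => b y z; rewrite linearP.
pose pr j := sval (prP j).
have prg j x : pr j (g x) = corner_orb (n j) x.
  by rewrite /pr; case: (prP j) => p /= ->; rewrite gE.
have pr_inj y z : (forall j, pr j y = pr j z) -> y = z.
  move=> E; apply: em_inj; apply: dprodP => j.
  by have := E j; rewrite /pr; case: (prP j) => p /= pE; rewrite !pE.
have pr_lc j (f : A -> A) w :
    pr j (lc (g \o f) w) = lc (fun x => corner_orb (n j) (f x)) w.
  by rewrite linear_lc; apply: eq_lc => x /=; rewrite prg.
have lcg0 w : lc g w = 0 -> forall j, lc (corner_orb (n j)) w = 0.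
  by move=> w0 j; rewrite -(pr_lc j id) w0 linear0.
have /choice[act actE] : forall a, exists f : {linear T -> T}, forall x, f (g x) = g (a * x).
  move=> a; have [w /lcg0 w0|f fE] := @linear_lift C A T T g gen (g \o *%R a);
    last by exists f.
  apply: pr_inj => j'; rewrite pr_lc linear0.
  (* Insert 1 as the sum of the e_i: the i-th piece is a relation in a corner containing [i], hence,
     multiplied by [a], a relation in every corner. *)
  rewrite (eq_lc (g' := fun x => \sum_i corner_orb (n j') (a * (e i * x)))).
    rewrite lc_sum big1 // => i _; have [j ij] := cover i.
    by apply: comp (ij) _; exact: (corner_orb_vert ij (w0 j)).
  by move=> x; rewrite -corner_orb_sum -mulr_sumr -mulr_suml va_sum mul1r.
have act1 y : act 1 y = y.
  have [h hE] : {h : {linear T -> T} | forall y, h y = y} by apply: linear_ex.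
  by rewrite -[RHS]hE; apply: (linear_eq gen) => x; rewrite hE actE mul1r.
have actM a b y : act (a * b) y = act a (act b y).
  have [h hE] : {h : {linear T -> T} | forall y, h y = act a (act b y)}.
    by apply: linear_ex => c x z; rewrite !linearP.
  by rewrite -hE; apply: (linear_eq gen) => x; rewrite hE !actE mulrA.
have actP (c : k) a b y : act (c *: a + b) y = (c%:A : C) *: act a y + act b y.
  have [h hE] : {h : {linear T -> T} |
      forall y, h y = (c%:A : C) *: act a y + act b y}.
    apply: linear_ex => d x z; rewrite (linearP (act a)) (linearP (act b)).
    by rewrite !scalerDr !scalerA mulrC addrACA.
  rewrite -hE; apply: (linear_eq gen) => x; rewrite hE !actE.
  apply: pr_inj => j; rewrite linearP !prg mulrDl -scalerAl.
  exact: corner_orbP.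
pose T' : rep A C := Rep act1 actM actP.
have corT j : exists (w : {linear N j -> T'}),
    [/\ forall y, pr j (w y) = y, forall x, w (pr j x) = rep_act T' (idem_sum (I j)) x,
      forall a y, w (rep_act (N j) a y) = rep_act T' (val a) (w y)
      & forall x, w (corner_orb (n j) x) = g (idem_sum (I j) * x)].
  have [w w0|w wE] := @linear_lift C A (N j) T (corner_orb (n j)) (@ngen j)
      (g \o *%R (idem_sum (I j))).
    apply: pr_inj => j'; rewrite pr_lc linear0 /idem_sum.
    rewrite (eq_lc (g' := fun x => \sum_(i in I j) corner_orb (n j') (1 * (e i * x)))).
      rewrite lc_sum big1 // => i ij.
      by apply: comp (ij) _; exact: (corner_orb_vert ij w0).
    by move=> x; rewrite -corner_orb_sum -mulr_sumr -mulr_suml mul1r.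
  exists w; split=> // [y|x|a y].
  - have [h hE] : {h : {linear N j -> N j} | forall y, h y = pr j (w y)}.
      by apply: linear_ex => c x z; rewrite !linearP.
    have [h' h'E] : {h' : {linear N j -> N j} | forall y, h' y = y} by apply: linear_ex.
    rewrite -hE -[RHS]h'E; apply: (linear_eq (@ngen j)) => x.
    by rewrite hE h'E wE prg corner_orb_idem.
  - have [h hE] : {h : {linear T -> T} | forall y, h y = w (pr j y)}.
      by apply: linear_ex => c y z; rewrite !linearP.
    rewrite -hE; apply: (linear_eq gen) => y.
    by rewrite hE prg wE actE.
  - have [h hE] : {h : {linear N j -> T} | forall y, h y = w (rep_act (N j) a y)}.
      by apply: linear_ex => c x z; rewrite !linearP.
    have [h' h'E] : {h : {linear N j -> T} | forall y, h y = act (val a) (w y)}.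
      by apply: linear_ex => c x z; rewrite !linearP.
    rewrite -hE -[RHS]h'E; apply: (linear_eq (@ngen j)) => x.
    rewrite hE h'E corner_orb_act !wE /= actE.
    by rewrite !mulrA val_corner_l val_corner_r.
have cor j : cornered T' (N j).
  by have [w [rw wr wact _]] := corT j; exact: (cornered_intro rw wr wact).
exists T' => //.
have [j rj] := cover (va_root A).
have [w [rw wr wact wE]] := corT j.
have troot := is_root_section rw wr wact (nroot j).
split.
- move=> i; have [j' ij] := cover i; have [w' [rw' wr' wact' _]] := corT j'.
  exact: (corner_locally_free_section rw' wr' wact' (lf j' (Sub i ij))).
- by exists (w (n j)); [exact: troot.1 | exact: troot.2].
apply: (stable_of_generated theta_gt0 troot) => y.
have [ww ->] := gen y; exists ww; apply: eq_lc => a.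
(* [a] and a e_I give the same tuple, because both act on the root sections as a e_0. *)
rewrite /orb -[n j]corner_orb1 wE mulr1 /= actE; apply: pr_inj => j'.
rewrite !prg -[RHS]corner_orb_root // -mulrA idem_sum_l rj.
exact/esym/corner_orb_root.
Qed.

End Glue.

(** * Compatibility as a closed condition *)

Section Compatibility.
Variables (k : fieldType) (A : vertex_algebra k) (l : nat).
Variables (I : 'I_l -> {set va_vert A}) (I0 : forall j, va_root A \in I j).
Local Notation AI j := (corner_algebra (I0 j)).
Local Notation e := (@va_idem k A).

(** Inside [T] the root sections of two corners differ by a scalar [b], so both presentations are
    read off from one module, where a relation may be multiplied by [a]. *)
Lemma compatible_of_cornered (C : comAlgType k) (T : rep A C)
    (N : forall j, rep (AI j) C) (n : forall j, N j) :
  (forall j, is_root (n j)) -> (forall j, cornered T (N j)) -> compatible n.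
Proof.
move=> nroot cor j j' i a ww iI w0.
have [w [r [rw wr wact]]] := cornered_retract (cor j).
have [w' [r' [r'w' w'r' w'act]]] := cornered_retract (cor j').
have [s0 sU] := is_root_section rw wr wact (nroot j).
have [s'0 _] := is_root_section r'w' w'r' w'act (nroot j').
have [b [bE _]] := sU _ s'0.
have wg x := corner_orb_section x (vert_corner (I0 j) s0) wact.
have w'g x := corner_orb_section x (vert_corner (I0 j') s'0) w'act.
have ss0 : lc (fun x => rep_act T (e i * x) (w (n j))) ww = 0.
  have := congr1 w w0; rewrite linear0 linear_lc => E; rewrite -[RHS]E.
  by apply: eq_lc => x /=; rewrite wg mulrA idem_sum_l iI.
apply: (retract_inj r'w'); rewrite linear0 linear_lc.
have -> : lc (w' \o (fun x => corner_orb (n j') (a * (e i * x)))) ww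
        = b *: rep_act T (idem_sum (I j') * a)
                 (lc (fun x => rep_act T (e i * x) (w (n j))) ww).
  rewrite linear_lc -lc_scale /lc big_map; apply: eq_bigr => p _ /=.
  by rewrite w'g bE mulrA rep_actM !linearZ /= scalerA mulrC.
by rewrite ss0 linear0 scaler0.
Qed.

(* The coordinates of the elements of the N_j whose vanishing means
   compatibility: the N_j glue over C exactly when these elements map to 0. *)
Definition gluing_locus (B : comAlgType k) (N : forall j, rep (AI j) B)
    (n : forall j, N j) (b : B) : Prop :=
  exists j j' i a w (lam : {linear N j' -> B^o}),
    [/\ i \in I j, lc (fun x => corner_orb (n j) (e i * x)) w = 0
      & b = lam (lc (fun x => corner_orb (n j') (a * (e i * x))) w)].

Section GluingLocus.
Variables (B C : comAlgType k) (phi : {lrmorphism B -> C}).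
Variables (N : forall j, rep (AI j) B) (N' : forall j, rep (AI j) C).
Variables (n : forall j, N j) (u : forall j, {linear N j -> N' j | phi \; *:%R}).
Hypothesis bc : forall j, is_base_change (u j).
Hypothesis uact : forall j a x, u j (rep_act (N j) a x) = rep_act (N' j) a (u j x).

(** Compatibility kills the element over [C], and each coordinate [lam] extends to the base
    change. *)
Lemma gluing_locus_of_compatible b :
  compatible (fun j => u j (n j)) -> gluing_locus n b -> phi b = 0.
Proof.
move=> comp [j [j' [i [a [w [lam [iI w0 ->]]]]]]].
set z := lc _ w.
have uz : u j' z = 0.
  rewrite /z corner_orb_pull; last exact: uact.
  apply: comp iI _; rewrite -corner_orb_pull ?w0 ?linear0 //; exact: uact.
have [h hE] := semilinear_dual phi lam.
have [[g gE] _] := bc h; have := gE z.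
by rewrite /= uz linear0 hE => <-.
Qed.

(** Relations over [C] are not lifted. The equations make x -> a e_i x a well defined map [h] on
    [N j], because it respects the relations over [B]; the universal property extends it to [N' j],
    where being a map already means respecting the relations over [C]. *)
Lemma compatible_of_gluing_locus (v : va_vert A -> nat) :
  (forall j i, locally_free (rep_vert (T := N j) i) (v (val i))) ->
  (forall j, generates (corner_orb (n j))) ->
  (forall b, gluing_locus n b -> phi b = 0) -> compatible (fun j => u j (n j)).
Proof.
move=> lf gen phi0 j j' i a w iI w0.
have [dual dualE] := family_dual_basis (v := corner_vector v (I0 j')) (lf j').
have [h hE] : {h : {linear N j -> N' j' | phi \; *:%R} |
    forall x, h (corner_orb (n j) x) = corner_orb (u j' (n j')) (a * (e i * x))}.
  apply: semilinear_lift => // s s0.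
  rewrite -corner_orb_pull; last exact: uact.
  rewrite [X in u j' X]dualE linear_sum big1 // => p _.
  rewrite semilinearZ -[RHS](scale0r (u j' p.2)); congr (_ *: _); apply: phi0.
  exists j, j', i, a, s, p.1; split=> //; exact: corner_orb_vert.
have [[g gE] _] := bc h.
have gg x : g (corner_orb (u j (n j)) x) = corner_orb (u j' (n j')) (a * (e i * x)).
  by rewrite -hE -gE /= /corner_orb uact.
have := congr1 g w0; rewrite linear0 linear_lc => E; rewrite -[RHS]E.
by apply: eq_lc => x /=; rewrite gg mulrA [e i * (e i * x)]mulrA va_orth eqxx -mulrA.
Qed.

End GluingLocus.
End Compatibility.

(** * The image of the moduli functor *)

Definition generated_ring_ideal (B : comNzRingType) (S : B -> Prop) (b : B) : Prop :=
  forall J, ideal_pred J -> (forall c, S c -> J c) -> J b.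

Lemma generated_ring_idealP (B : comNzRingType) (S : B -> Prop) :
  ideal_pred (generated_ring_ideal S).
Proof.
split=> [J [] //|x y Sx Sy J Jid JS|b x Sx J Jid JS].
  by have [_ JD _] := Jid; apply: JD; [exact: Sx | exact: Sy].
by have [_ _ JM] := Jid; apply: JM; exact: Sx.
Qed.

Lemma generated_ring_ideal_ker (B C : comNzRingType) (phi : {rmorphism B -> C})
    (S : B -> Prop) b :
  (forall c, S c -> phi c = 0) -> generated_ring_ideal S b -> phi b = 0.
Proof.
move=> S0 /(_ (fun b => phi b = 0)); apply=> //.
split=> [|x y x0 y0|c x x0]; first exact: rmorph0.
  by rewrite rmorphD x0 y0 addr0.
by rewrite rmorphM x0 mulr0.
Qed.

Section RootSection.
Variables (k : fieldType) (A : vertex_algebra k).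
Variables (v : va_vert A -> nat) (theta : va_vert A -> rat).
Hypothesis v_root : v (va_root A) = 1%N.

Lemma stable_family_root (B : comAlgType k) (T : rep A B) :
  \sum_i theta i * (v i)%:R = 0 -> (forall i, i != va_root A -> 0 < theta i) ->
  stable_family v theta T -> exists t : T, is_root t /\ generates (orb t).
Proof.
move=> theta_v theta_gt0 [lf [t t0 tU] st].
have troot : is_root t by split.
exists t; split=> //; exact: (generated_of_stable v_root theta_v theta_gt0 lf st troot).
Qed.

End RootSection.

Section ProductOfCornerings.
Variables (k : fieldType) (A : vertex_algebra k) (l : nat).
Variables (I : 'I_l -> {set va_vert A}) (I0 : forall j, va_root A \in I j).
Hypothesis cover : forall i, exists j, i \in I j.
Local Notation AI j := (corner_algebra (I0 j)).
Variables (v : va_vert A -> nat) (theta : va_vert A -> rat).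
Variable thetaI : forall j, va_vert (AI j) -> rat.
Hypothesis v_root : v (va_root A) = 1%N.
Hypothesis theta_v : \sum_i theta i * (v i)%:R = 0.
Hypothesis theta_gt0 : forall i, i != va_root A -> 0 < theta i.
Hypothesis thetaI_v :
  forall j, \sum_i thetaI i * (corner_vector v (I0 j) i)%:R = 0.
Hypothesis thetaI_gt0 : forall j (i : va_vert (AI j)), i != va_root (AI j) -> 0 < thetaI i.

Local Notation X := (moduli v theta).
Local Notation Y j := (moduli (corner_vector v (I0 j)) (@thetaI j)).
Local Notation F := (kprod_graph (fun j => cornering v theta (I0 j) (@thetaI j))).

Let root_data (B : comAlgType k) (x : X B) :
  exists t : sval x, is_root t /\ generates (orb t).
Proof. exact: (stable_family_root v_root theta_v theta_gt0 (svalP x)). Qed.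

Let corner_data (B : comAlgType k) j (y : Y j B) :
  exists n : sval y, is_root n /\ generates (orb n).
Proof.
exact: (stable_family_root (v := corner_vector v (I0 j)) v_root
  (@thetaI_v j) (@thetaI_gt0 j) (svalP y)).
Qed.

(** For the identity this is injectivity on points; a general [phi] serves to recognise points over
    [C] as pull-backs of a glued point. *)
Lemma pull_of_corners (B C : comAlgType k) (phi : {lrmorphism B -> C})
    (x : X B) (x' : X C) (y : kproduct (fun j => Y j) B) (y' : kproduct (fun j => Y j) C) :
  F x y -> F x' y' -> pull (kproduct (fun j => Y j)) phi y y' -> pull X phi x x'.
Proof.
move=> xy xy' yy'; have [t [troot gen]] := root_data x.
have [t' [troot' _]] := root_data x'.
exact: (cover_pull cover troot troot' gen xy xy' yy').
Qed.

Lemma kprod_kmorphism : kmorphism (kred_graph F).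
Proof.
split=> [B [x xred]|B C phi [x xred] y [x' x'red] y' /= xy xy' xx' j]; last first.
  exact: cornered_pull xx' (xy j) (xy' j).
have [t [troot gen]] := root_data x.
have lf : forall i, locally_free (rep_vert (T := sval x) i) (v i).
  by have [] := svalP x.
have ex j : exists y : Y j B, cornering v theta (I0 j) (@thetaI j) _ x y.
  have [N st cor] := corner_family (@thetaI_gt0 j) lf troot gen.
  by exists (exist _ N st).
by exists (fun j => sval (cid (ex j))) => j; exact: svalP (cid (ex j)).
Qed.

Lemma kimageE (C : comAlgType k) (y : kproduct (fun j => Y j) C) :
  kimage (kred_graph F) y <-> exists2 x : X C, red_points x & F x y.
Proof.
split=> [[[x xred] [y' [/= xy' y'y]]]|[x xred xy]].
  by exists x => // j; exact: cornered_same (xy' j) (y'y j).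
exists (exist _ x xred), y; split=> // j.
have [i iE] := linear_to_id (idfun : {linear sval (y j) -> sval (y j)}).
exists i => [P h|a z]; last by rewrite !iE.
have [h' h'E] := linear_of_id h; split; first by exists h' => z /=; rewrite iE h'E.
by move=> g g' E z; have := E z; rewrite /= iE.
Qed.

Lemma kprod_closed_image : closed_subfunctor (kimage (kred_graph F)).
Proof.
move=> B y.
pose N j := sval (y j).
pose n j : N j := sval (cid (corner_data (y j))).
have nroot j : is_root (n j) by have [] := svalP (cid (corner_data (y j))).
have ngen j : generates (corner_orb (n j)).
  by apply: generates_corner_orb; have [] := svalP (cid (corner_data (y j))).
have lf j i : locally_free (rep_vert (T := N j) i) (v (val i)).
  by have [] := svalP (y j).
pose S1 := gluing_locus n.
have image_kills (C : comAlgType k) (phi : {lrmorphism B -> C}) y' (x : X C) :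
    pull (kproduct (fun j => Y j)) phi y y' -> F x y' ->
    forall b, S1 b -> phi b = 0.
  move=> yy' xy' b Sb.
  have uP j := cid2 (yy' j).
  apply: (gluing_locus_of_compatible (u := fun j => s2val (uP j)) _ _ _ Sb).
  - by move=> j; exact: (s2valP (uP j)).
  - by move=> j; exact: (s2valP' (uP j)).
  apply: compatible_of_cornered xy' => j.
  apply: root_pull (s2valP (uP j)) (s2valP' (uP j)) (nroot j) _.
  by have [n' []] := corner_data (y' j); exists n'.
have kills_glue (C : comAlgType k) (phi : {lrmorphism B -> C}) y' :
    pull (kproduct (fun j => Y j)) phi y y' -> (forall b, S1 b -> phi b = 0) ->
    exists x : X C, F x y'.
  move=> yy' S0; have uP j := cid2 (yy' j).
  pose n' j : sval (y' j) := s2val (uP j) (n j).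
  have n'root j : is_root (n' j).
    apply: root_pull (s2valP (uP j)) (s2valP' (uP j)) (nroot j) _.
    by have [n'' []] := corner_data (y' j); exists n''.
  have n'gen j : generates (corner_orb (n' j)).
    apply: generates_corner_orb; have [lf' _ st] := svalP (y' j).
    exact: (generated_of_stable (v := corner_vector v (I0 j)) v_root
      (@thetaI_v j) (@thetaI_gt0 j) lf' st (n'root j)).
  have comp : compatible n'.
    apply: (compatible_of_gluing_locus (u := fun j => s2val (uP j)) _ _ lf ngen S0).
    - by move=> j; exact: (s2valP (uP j)).
    - by move=> j; exact: (s2valP' (uP j)).
  have lf' j i : locally_free (rep_vert (T := sval (y' j)) i) (v (val i)).
    by have [] := svalP (y' j).
  have [T st cor] := glue cover n'root n'gen comp theta_gt0 lf'.
  by exists (exist _ T st).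
(* Algebras are nonzero here: if [S1] generates the unit ideal, no map out of [B] kills it and no
   pull-back of [y] lies in the image. Otherwise the quotient by [S1] is available. *)
have [J1|J1] := lem (generated_ring_ideal S1 1).
  exists S1 => C phi y' yy'; rewrite kimageE; split=> [[x _ xy']|S0].
    exact: image_kills yy' xy'.
  have /eqP[] : (1 : C) != 0 := oner_neq0 _.
  rewrite -(rmorph1 phi); exact: generated_ring_ideal_ker S0 J1.
have [D [pi [pi_surj pi_ker]]] := quotient_algebra (generated_ring_idealP S1) J1.
have piS1 b : S1 b -> pi b = 0.
  by move=> Sb; apply/pi_ker => J _; apply.
have exD j : exists (yD : Y j D) (u : {linear N j -> sval yD | pi \; *:%R}),
    quotient_map u /\ forall a x, u (rep_act (N j) a x) = rep_act (sval yD) a (u x).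
  have gen : generates (orb (n j)) by have [] := svalP (cid (corner_data (y j))).
  have [N' [u [qu uact st]]] :=
    pull_quotient pi_surj (@thetaI_gt0 j) (lf j) (nroot j) gen.
  by exists (exist _ N' st), u.
pose yD : kproduct (fun j => Y j) D := fun j => sval (cid (exD j)).
have yDP j := svalP (cid (exD j)).
have yyD : pull (kproduct (fun j => Y j)) pi y yD.
  move=> j; have [u [qu uact]] := yDP j; exists u => //.
  exact: quotient_map_base_change.
(* Over [D] the gluing equations hold by construction. *)
have [xD xyD] := kills_glue _ _ _ yyD piS1.
(* [xD] is universal: [phi] factors through [D], the corners of [xD] pull back to [y'], and corners
   determine the point. *)
have factor (C : comAlgType k) (phi : {lrmorphism B -> C}) y' (x : X C) :
    pull (kproduct (fun j => Y j)) phi y y' -> F x y' ->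
    exists2 psi : {lrmorphism D -> C}, forall b, psi (pi b) = phi b & pull X psi xD x.
  move=> yy' xy'.
  have S0 := image_kills C phi y' x yy' xy'.
  have [|psi psiE] := lrmorphism_lift (phi := phi) pi_surj.
    by move=> b /pi_ker; apply: generated_ring_ideal_ker.
  exists psi => //; apply: pull_of_corners xyD xy' _ => j.
  have [u [qu uact]] := yDP j; have [u' bc' u'act] := yy' j.
  have [w [wE bc]] := quotient_map_factor pi_surj psiE qu bc'.
  exists w => // a z; have [z' <-] := qu.1 z.
  by rewrite -uact !wE u'act.
(* The pull-back to B of the ideals cutting out, in the point [xD] over D, the
   closed subfunctors that contain all reduced points. *)
pose S2 b := exists Z : forall C : comAlgType k, X C -> Prop,
  [/\ closed_subfunctor Z, forall (C : comAlgType k) (x : X C), reduced_ring C -> Z C x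
    & exists S : D -> Prop,
        (forall (C : comAlgType k) (psi : {lrmorphism D -> C}) (x : X C),
           pull X psi xD x -> (Z C x <-> forall d, S d -> psi d = 0)) /\ S (pi b)].
exists (fun b => S1 b \/ S2 b) => C phi y' yy'; rewrite kimageE; split.
  move=> [x xred xy'] b [Sb|[Z [Zcl Zred [S [SP Sb]]]]].
    exact: image_kills yy' xy' b Sb.
  have [psi psiE xDx] := factor C phi y' x yy' xy'.
  by rewrite -psiE; apply: (SP C psi x xDx).1 Sb; exact: xred.
move=> S0; have [x xy'] : exists x : X C, F x y'.
  by apply: kills_glue yy' _ => b Sb; apply: S0; left.
exists x => // Z Zcl Zred.
have [psi psiE xDx] := factor C phi y' x yy' xy'.
have [S SP] := Zcl D xD; apply/(SP C psi x xDx) => d Sd.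
have [b bd] := pi_surj d; rewrite -bd psiE; apply: S0; right.
by exists Z; split=> //; exists S; rewrite bd.
Qed.

Lemma kprod_closed_immersion : closed_immersion (kred_graph F).
Proof.
split; [exact: kprod_kmorphism| |exact: kprod_closed_image].
move=> B [x xred] y [x' x'red] y' /= xy xy' yy'.
exact: pull_of_corners xy xy' yy'.
Qed.

End ProductOfCornerings.

Theorem theorem1p1 (k : closedFieldType) (k_char0 : [pchar k] =i pred0)
  (n : nat) (Q : quiver n) (Q_connected : quiver_connected Q)
  (A : quiver_algebra k Q)
  (v : 'I_n.+1 -> nat) (v_root : v ord0 = 1%N)
  (theta : 'I_n.+1 -> rat)
  (theta_gen : stability_parameter (A := quiver_vertex_algebra A) v theta)
  (l : nat) (I : 'I_l -> {set 'I_n.+1})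
  (I_cover : \bigcup_(j < l) I j = [set: 'I_n.+1])
  (I_root : forall j, ord0 \in I j)
  (thetaI : forall j, va_vert (corner_algebra (A := quiver_vertex_algebra A) (I_root j)) -> rat)
  (thetaI_gen : forall j,
     stability_parameter (corner_vector (A := quiver_vertex_algebra A) v (I_root j)) (@thetaI j)) :
  closed_immersion
    (kred_graph
       (kprod_graph
          (fun j => cornering (A := quiver_vertex_algebra A) v theta (I_root j) (@thetaI j)))).
Proof.
have [theta_v theta_gt0 _] := theta_gen.
apply: kprod_closed_immersion => //.
- move=> i; have : i \in [set: 'I_n.+1] by rewrite inE.
  by rewrite -I_cover => /bigcupP[j _ ij]; exists j.
- by move=> j; have [] := thetaI_gen j.
- by move=> j; have [] := thetaI_gen j.
Qed.
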